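(* Let $d\ge 3$ and let $p$ be a prime number. Let $$f\colon \mathbb{P}^2_{\overline{\mathbb{Q}}}\dashrightarrow\mathbb{P}^2_{\overline{\mathbb{Q}}},\qquad (x:y:z)\mapsto\Big(x^d-\tfrac{1}{p^{d-3}}y^2z^{d-2} : xy^2z^{d-3} : y^2z^{d-2}\Big).$$ (1) We have $d_1(f)=d$ and $d_2(f)=2$. In particular, $f$ is $1$-cohomologically hyperbolic. (2) Let $d=4$, $p=2$, and let $P_0=\big(\tfrac{1+\sqrt3}{2}:\tfrac{1+\sqrt3}{2}:1\big)$. Then $f(P_0)=P_0$, and there is a sequence of points $\{P_n\}_{n\ge1}$ of $(\mathbb{P}^2\setminus I_f)(\overline{\mathbb{Q}})$ such that $f(P_n)=P_{n-1}$ for $n\ge 1$, the set $\{P_n\mid n\ge 0\}$ is Zariski dense (in $\mathbb{P}^2$), and $\lim_{n\to\infty}h(P_n)=\infty$.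
   Context: $I_f$ is the indeterminacy locus of $f$; $h$ is the naive logarithmic height function on $\mathbb{P}^2(\overline{\mathbb{Q}})$. Dynamical degrees: for a dominant rational map $f\colon X\dashrightarrow X$ on a projective variety of dimension $N$ over an algebraically closed field and an ample divisor $H$, $d_i(f)=\lim_{n\to\infty}\big((f^n)^*H^i\cdot H^{N-i}\big)^{1/n}$, computed on the graph of $f^n$ (or a projective birational model dominating it). For $X=\mathbb{P}^2$, $d_1(f)=\lim_n \deg(f^n)^{1/n}$ and $d_2(f)$ is the topological degree. $f$ is $p$-cohomologically hyperbolic if $p$ is the unique element of $\{1,\dots,\dim X\}$ with $d_p(f)=\max\{d_i(f)\mid 1\le i\le\dim X\}$. *)

(* Defs.v *)
From mathcomp Require Import all_boot all_order all_algebra all_field finmap.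
From mathcomp Require Import boolp classical_sets functions cardinality fsbigop.
From mathcomp Require Import reals topology num_normedtype sequences exp.
From mathcomp Require Import mpoly.

Set Implicit Arguments.
Unset Strict Implicit.
Unset Printing Implicit Defensive.

Import Order.TTheory GRing.Theory Num.Theory.
Import numFieldTopology.Exports.

Local Open Scope classical_set_scope.
Local Open Scope card_scope.
Local Open Scope ring_scope.

(* The field of algebraic numbers is [algC].  A point of P^2 is given by a
   nonzero row vector of homogeneous coordinates. *)

Definition P2 : set 'rV[algC]_3 := [set x | x != 0].

(* [genmx x] is a canonical matrix for the line spanned by x, so for nonzero
   x and y, [pt x = pt y] iff x and y are proportional. *)
Definition pt (x : 'rV[algC]_3) : 'M[algC]_3 := <<x>>%MS.

Definition coords (x y z : algC) : 'rV[algC]_3 :=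
  \row_(i < 3) [:: x; y; z]`_i.

(* Zariski topology of P^2 *)

Definition homogeneous_set (I : set {mpoly algC[3]}) : Prop :=
  forall q, I q -> exists k : nat, q \is k.-homog.

Definition zero_locus (I : set {mpoly algC[3]}) : set 'rV[algC]_3 :=
  [set x | x != 0 /\ forall q, I q -> q.@[x 0] = 0].

Definition zariski_dense (S : set 'rV[algC]_3) : Prop :=
  forall I, homogeneous_set I -> S `<=` zero_locus I -> P2 `<=` zero_locus I.

(* Rational maps P^2 --> P^2 are given by triples of forms of the same degree.
   A triple G of forms of degree e is reduced if its entries have no
   nonconstant common factor; [is_reduced_form F e G] says that G is a reduced
   triple of degree e defining the same rational map as the triple F.  It is
   unique up to a nonzero scalar. *)

Notation triple := (3.-tuple {mpoly algC[3]}).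

Definition coprime_triple (G : triple) : Prop :=
  forall D : {mpoly algC[3]},
    (forall i, exists Q, tnth G i = D * Q) -> exists c : algC, D = c%:MP.

Definition is_reduced_form (F : triple) (e : nat) (G : triple) : Prop :=
  [/\ (forall i, tnth G i \is e.-homog), coprime_triple G,
      (exists i, tnth F i != 0) &
      forall i j, tnth F i * tnth G j = tnth F j * tnth G i].

Definition eval_triple (G : triple) (x : 'rV[algC]_3) : 'rV[algC]_3 :=
  \row_i (tnth G i).@[x 0].

Definition indeterminacy_locus (F : triple) : set 'rV[algC]_3 :=
  [set x | x != 0 /\
    forall e G, is_reduced_form F e G -> eval_triple G x = 0].

(* For nonzero x and y: x is not an indeterminacy point and f(x) = y. *)
Definition maps_to (F : triple) (x y : 'rV[algC]_3) : Prop :=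
  exists e G, [/\ is_reduced_form F e G, eval_triple G x != 0 &
                  pt (eval_triple G x) = pt y].

Definition comp_triple (F G : triple) : triple := [tuple tnth F i \mPo G | i < 3].

Definition iter_triple (F : triple) (n : nat) : triple :=
  iter n (comp_triple F) [tuple 'X_i | i < 3].

(* The fibre over a general point y, for a reduced triple G: it has m
   points as soon as y avoids some proper Zariski closed subset. *)
Definition general_fibre_card (G : triple) (m : nat) : Prop :=
  exists I, [/\ homogeneous_set I, exists y, P2 y /\ ~ zero_locus I y &
    forall y, P2 y -> ~ zero_locus I y ->
      [set pt x | x in [set x | [/\ P2 x, eval_triple G x != 0 &
                                    pt (eval_triple G x) = pt y]]] #= `I_m].

(* The intersection number (f^*H^i . H^(2-i)) for a line H, on (the graph of)
   a rational self-map f of P^2: the algebraic degree of f for i = 1 and its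
   topological degree for i = 2. *)
Definition is_ith_degree (i : nat) (F : triple) (m : nat) : Prop :=
  exists e G, is_reduced_form F e G /\
    match i with
    | 1 => m = e
    | 2 => general_fibre_card G m
    | _ => False
    end.

Definition is_dynamical_degree (R : realType) (i : nat) (F : triple) (delta : R)
    : Prop :=
  exists m : nat -> nat, (forall n, is_ith_degree i (iter_triple F n) (m n)) /\
    (fun n => (m n)%:R `^ n%:R^-1 : R) @ \oo --> delta.

Definition cohomologically_hyperbolic (R : realType) (k : nat) (F : triple)
    : Prop :=
  exists delta : nat -> R,
    (forall i, (1 <= i <= 2)%N -> is_dynamical_degree i F (delta i)) /\
    let attains_max j :=
      (1 <= j <= 2)%N /\ forall i, (1 <= i <= 2)%N -> delta i <= delta j in
    attains_max k /\ forall j, attains_max j -> j = k.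

(* The naive logarithmic height.  Places of Q are encoded in [option nat]:
   [None] is the archimedean one, [Some p] the p-adic one, with
   |p|_p = 1/p. *)

Definition placesQ : set (option nat) :=
  [set v | if v is Some p then prime p else true].

Definition absQ (R : realType) (v : option nat) (q : rat) : R :=
  match v with
  | None => ratr `|q|
  | Some p => if q == 0 then 0 else
      (p ^ logn p `|denq q|)%:R / (p ^ logn p `|numq q|)%:R
  end.

Definition extends_place (R : realType) (v : option nat) (w : algC -> R)
    : Prop :=
  [/\ forall a, 0 <= w a /\ (w a = 0 <-> a = 0),
      {morph w : a b / a * b},
      forall a b, w (a + b) <= w a + w b &
      forall q : rat, w (ratr q) = absQ R v q].

(* A chosen extension to Qbar of the absolute value v of Q.  All extensions are
   conjugate under Gal(Qbar/Q), so the height does not depend on the choice. *)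
Definition absv (R : realType) (v : option nat) : algC -> R :=
  xget (fun=> 0) [set w | extends_place v w].

Definition galois_orbit (x : 'rV[algC]_3) : set 'rV[algC]_3 :=
  [set map_mx s x | s in [set: {rmorphism algC -> algC}]].

(* For K = Q(x_0, x_1, x_2), the sum over the places of K above v, weighted by
   their local degrees, is the sum over the embeddings K -> Qbar composed with
   the chosen extension of v; these embeddings correspond bijectively to the
   Galois conjugates of the vector x.  Hence this is
     h(x) = 1/[K:Q] * \sum_(w place of K) [K_w:Q_v] * log max_i |x_i|_w,
   which by the product formula depends only on the point of P^2. *)
Definition height (R : realType) (x : 'rV[algC]_3) : R :=
  (\sum_(v \in placesQ) \sum_(t \in galois_orbit x)
     ln (\big[Num.max/0]_(i < 3) absv R v (t 0 i)))
  / (#|` fset_set (galois_orbit x)|)%:R.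

(* (x^d - p^-(d-3) y^2 z^(d-2) : x y^2 z^(d-3) : y^2 z^(d-2)), for 3 <= d *)
Definition ratmap_f (d p : nat) : triple :=
  let x : {mpoly algC[3]} := 'X_(inord 0) in
  let y : {mpoly algC[3]} := 'X_(inord 1) in
  let z : {mpoly algC[3]} := 'X_(inord 2) in
  [tuple x ^+ d - (p%:R ^- (d - 3)) *: (y ^+ 2 * z ^+ (d - 2));
         x * y ^+ 2 * z ^+ (d - 3);
         y ^+ 2 * z ^+ (d - 2)].

(* Main.v *)
Require Import Defs.
From mathcomp Require Import all_boot all_order all_algebra all_field finmap.
From mathcomp Require Import boolp classical_sets functions cardinality fsbigop.
From mathcomp Require Import reals topology num_normedtype sequences exp mpoly.
From mathcomp Require Import ring lra zify.

Import Order.TTheory GRing.Theory Num.Theory.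
Import numFieldTopology.Exports.

Set Implicit Arguments.
Unset Strict Implicit.

Local Open Scope classical_set_scope.
Local Open Scope card_scope.
Local Open Scope ring_scope.

(** In the chart z = 1 the map is f(x, y) = (x^d / y^2 - c, x) with
    c = p^-(d-3).

    Degrees.  All components of f^n vanish at a point only if x = 0 and yz = 0
    there.  This set contains no curve, so the components have no common factor
    and deg f^n = d^n.  A point (u, v) with v != 0 and u != -c has the two
    preimages (v, y), y^2 = v^d / (u + c); taking norms down these double
    covers gives a form off whose zeros f^n has 2^n preimages.

    Backward orbit.  For d = 4, p = 2 a backward orbit has the form
    P_n = (u_n, u_(n+1)) with u_(n+1)^2 = u_n^4 / (u_(n-1) + 1/2).  Starting with
    u_0 = u_1 = u_3 = a and u_2 = -a, the prime 3 enters because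
    (1/2 - a)^2 = 3/4.  From then on g_n = log |u_(n+4)|_3 satisfies
    g_(n+2) = 2 g_(n+1) - g_n / 2 for every choice of square roots and for
    every Galois conjugate, so it grows exponentially and bounds the height
    from below.  Moreover g_(n+1) - r g_n is bounded, where r = 1 + 1/sqrt 2 is
    irrational; hence in a nonzero form a single monomial dominates 3-adically
    along the orbit, which is therefore Zariski dense. *)

(** * Extension of the p-adic absolute value to the algebraic numbers *)

Definition is_subring (K : fieldType) (A : set K) : Prop :=
  A 1 /\ forall x y, A x -> A y -> A (x - y) /\ A (x * y).

Lemma subring0 (K : fieldType) (A : set K) : is_subring A -> A 0.
Proof. by move=> [A1 AA]; rewrite -(subrr 1); exact: (AA 1 1 A1 A1).1. Qed.

Lemma subringB (K : fieldType) (A : set K) x y :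
  is_subring A -> A x -> A y -> A (x - y).
Proof. by move=> [_ AA] Ax Ay; exact: (AA _ _ Ax Ay).1. Qed.

Lemma subringM (K : fieldType) (A : set K) x y :
  is_subring A -> A x -> A y -> A (x * y).
Proof. by move=> [_ AA] Ax Ay; exact: (AA _ _ Ax Ay).2. Qed.

Lemma subringD (K : fieldType) (A : set K) x y :
  is_subring A -> A x -> A y -> A (x + y).
Proof.
move=> Ar Ax Ay; rewrite -[y]opprK -[- y]sub0r.
by apply: subringB => //; apply: subringB => //; exact: subring0.
Qed.

Lemma subringX (K : fieldType) (A : set K) x n :
  is_subring A -> A x -> A (x ^+ n).
Proof.
move=> Ar Ax; elim: n => [|n IH]; first by rewrite expr0; case: Ar.
by rewrite exprS; exact: subringM.
Qed.

Lemma subring_sum (K : fieldType) (A : set K) (I : Type) (r : seq I) (P : pred I) F :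
  is_subring A -> (forall i, P i -> A (F i)) -> A (\sum_(i <- r | P i) F i).
Proof.
move=> Ar AF; apply: big_ind => //; first exact: subring0.
by move=> x y; exact: subringD.
Qed.

Lemma subring_nat (K : fieldType) (A : set K) n : is_subring A -> A n%:R.
Proof.
move=> Ar; elim: n => [|n IH]; first exact: subring0.
by rewrite -addn1 natrD; apply: subringD => //; case: Ar.
Qed.

Definition max_avoiding (K : fieldType) (c : K) (A : set K) : Prop :=
  [/\ is_subring A, ~ A c &
    forall B, is_subring B -> A `<=` B -> ~ B c -> B `<=` A].

Lemma exists_max_subring (K : fieldType) (c : K) (B0 : set K) :
  is_subring B0 -> ~ B0 c ->
  exists A : set K, max_avoiding c A.
Proof.
move=> B0r B0c.
have [F FP totF|A [[->|[Ar Ac]] Amax]] :=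
    @Zorn_bigcup K (fun A => A = set0 \/ is_subring A /\ ~ A c).
- have [[X [FX X0]]|noX] := pselect (exists X, F X /\ X !=set0); last first.
    left; apply/seteqP; split => // x [X FX Xx]; case: noX.
    by exists X; split => //; exists x.
  have subr Y x : F Y -> Y x -> is_subring Y.
    by move=> FY Yx; case: (FP _ FY) => [Y0|[]//]; rewrite Y0 in Yx.
  right; split; last first.
    by move=> [Y FY Yc]; case: (FP _ FY) => [Y0|[]//]; rewrite Y0 in Yc.
  split; first by case: X0 => x Xx; exists X => //; case: (subr _ _ FX Xx).
  move=> x y [Y FY Yx] [Z FZ Zy].
  have Yr := subr _ _ FY Yx; have Zr := subr _ _ FZ Zy.
  case: (totF _ _ FY FZ) => [YZ|ZY].
  + by split; exists Z => //; [apply: subringB|apply: subringM] => //; exact: YZ.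
  + by split; exists Y => //; [apply: subringB|apply: subringM] => //; exact: ZY.
- case: (Amax B0); last by right.
  by split=> // B00; apply: (B00 1); case: B0r.
- exists A; split => // B Br AB Bc; apply: contrapT => BA.
  by apply: (Amax B); [split | right].
Qed.

Definition coefs_in (K : fieldType) (A : set K) (P : {poly K}) : Prop :=
  forall i, A P`_i.

Definition adjoin (K : fieldType) (A : set K) (x : K) : set K :=
  [set y | exists2 P, coefs_in A P & y = P.[x]].

Lemma coefs_inM (K : fieldType) (A : set K) P Q :
  is_subring A -> coefs_in A P -> coefs_in A Q -> coefs_in A (P * Q).
Proof.
move=> Ar AP AQ i; rewrite coefM; apply: subring_sum => // j _.
exact: subringM.
Qed.

Lemma coefs_inB (K : fieldType) (A : set K) P Q :
  is_subring A -> coefs_in A P -> coefs_in A Q -> coefs_in A (P - Q).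
Proof. by move=> Ar AP AQ i; rewrite coefB; exact: subringB. Qed.

Lemma coefs_inC (K : fieldType) (A : set K) c :
  is_subring A -> A c -> coefs_in A c%:P.
Proof. by move=> Ar Ac i; rewrite coefC; case: eqP => // _; exact: subring0. Qed.

Lemma coefs_inX (K : fieldType) (A : set K) n :
  is_subring A -> coefs_in A 'X^n.
Proof.
move=> Ar i; rewrite coefXn; exact: subring_nat.
Qed.

Lemma adjoin_subring (K : fieldType) (A : set K) x :
  is_subring A -> is_subring (adjoin A x).
Proof.
move=> Ar; split.
  by exists 1; [rewrite -(expr0 'X); exact: coefs_inX | rewrite hornerC].
move=> _ _ [P AP ->] [Q AQ ->]; split.
  by exists (P - Q); [exact: coefs_inB | rewrite !hornerE].
by exists (P * Q); [exact: coefs_inM | rewrite !hornerE].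
Qed.

Lemma adjoin_sub (K : fieldType) (A : set K) x :
  is_subring A -> A `<=` adjoin A x.
Proof. by move=> Ar a Aa; exists a%:P; [exact: coefs_inC | rewrite hornerC]. Qed.

Lemma adjoin_mem (K : fieldType) (A : set K) x :
  is_subring A -> adjoin A x x.
Proof. by move=> Ar; exists 'X^1; [exact: coefs_inX | rewrite expr1 hornerX]. Qed.

Lemma max_adjoin (K : fieldType) (c : K) (A : set K) x :
  max_avoiding c A -> ~ A x -> adjoin A x c.
Proof.
move=> [Ar Ac Amax] Ax; apply: contrapT => nc; apply: Ax.
apply: (Amax _ _ _ nc); [exact: adjoin_subring| exact: adjoin_sub|].
exact: adjoin_mem.
Qed.

(* [pi] lies in the Jacobson radical of the maximal ring. *)
Lemma max_unit (K : fieldType) (pi : K) (A : set K) b :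
  max_avoiding pi^-1 A -> A pi -> A b -> A (1 - pi * b)^-1.
Proof.
move=> Am Api Ab; have [Ar Ac _] := Am.
have pi0 : pi != 0.
  by apply/eqP => pi0; apply: Ac; rewrite pi0 invr0; exact: subring0.
have Au : A (1 - pi * b) by apply: subringB; [|case: Ar|exact: subringM].
have [u0|u0] := eqVneq (1 - pi * b) 0; first by rewrite u0 invr0; exact: subring0.
apply: contrapT => /(max_adjoin Am) [P AP eqP].
set u := 1 - pi * b in Au u0 eqP *.
(* [P] has degree less than [size P], so multiplying the relation by this power of [u] removes all
   negative powers of [u]. *)
have Auc : A (u ^+ size P * pi^-1).
  rewrite eqP horner_coef mulr_sumr; apply: subring_sum => // i _.
  rewrite mulrCA; apply: subringM => //.
  rewrite exprVn -expfB // ; first by exact: subringX.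
(* Powers of [u] are congruent to 1 modulo [pi]; hence [u ^+ size P / pi] differs from [pi^-1] by an
   element of [A]. *)
have [w Aw ew] : exists2 w, A w & u ^+ size P = 1 - pi * w.
  elim: (size P) => [|n [w Aw ew]].
    by exists 0; [exact: subring0 | rewrite mulr0 subr0].
  exists (b + w - pi * (b * w)).
    apply: subringB => //; first exact: subringD.
    by do 2!apply: subringM => //.
  by rewrite exprS ew /u; ring.
apply: Ac.
have -> : pi^-1 = u ^+ size P * pi^-1 + w.
  by rewrite ew mulrBl mul1r mulrAC mulfV // mul1r subrK.
exact: subringD.
Qed.

(** The relation in [x^-1] has constant term [Q_0] with [1 - pi * Q_0] a unit, so after
    multiplication by [x ^+ m] it expresses [x ^+ m] through lower powers of [x]. Substituting this
    into the leading term of [P] lowers the degree. *)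
Lemma reduce_degree (K : fieldType) (pi : K) (A : set K) x n m P Q :
  max_avoiding pi^-1 A -> A pi -> x != 0 -> (m <= n)%N ->
  coefs_in A P -> (size P <= n.+1)%N -> P.[x] = pi^-1 ->
  coefs_in A Q -> (size Q <= m.+1)%N -> Q.[x^-1] = pi^-1 ->
  exists P', [/\ coefs_in A P', (size P' <= n)%N & P'.[x] = pi^-1].
Proof.
move=> Am Api x0 mn AP sP eP AQ sQ eQ.
have [Ar Ac _] := Am.
have pi0 : pi != 0.
  by apply/eqP => pi0; apply: Ac; rewrite pi0 invr0; exact: subring0.
have Au := max_unit Am Api (AQ 0%N); set u := 1 - pi * Q`_0 in Au.
have u0 : u != 0.
  apply/eqP => u0; apply: Ac; rewrite (_ : pi^-1 = Q`_0) //.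
  by apply: (mulfI pi0); rewrite mulfV //; apply/eqP; rewrite -subr_eq0; apply/eqP.
(* [S] is the expression of [x ^+ m] by lower powers, obtained from
   [u = \sum_(i >= 1) pi * Q_i * x ^- i]. *)
pose S := \poly_(i < m) (u^-1 * (pi * Q`_(m - i))).
have AS : coefs_in A S.
  move=> i; rewrite coef_poly; case: ifP => _; last exact: subring0.
  by do 2!apply: subringM => //.
have eS : S.[x] = x ^+ m.
  have : 1 = pi * Q.[x^-1] by rewrite eQ mulfV.
  rewrite (horner_coef_wide _ sQ) big_ord_recl /= expr0 mulr1 mulrDr => e1.
  apply: (mulfI u0); rewrite [RHS]mulrBl mul1r.
  move: e1 => /(congr1 ( *%R (x ^+ m))); rewrite mulr1 mulrDr => {1}->.
  rewrite addrAC [x ^+ m * (pi * Q`_0)]mulrC subrr add0r.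
  rewrite horner_poly !mulr_sumr (reindex_inj rev_ord_inj) /=.
  apply: eq_bigr => i _; rewrite -!mulrA mulVKf //.
  rewrite subKn // /bump leq0n add1n exprVn [RHS]mulrCA; congr (_ * _).
  rewrite [RHS]mulrCA; congr (_ * _).
  have <- : x ^+ (m - i.+1) * x ^+ i.+1 = x ^+ m by rewrite -exprD subnK.
  by rewrite mulfK // expf_neq0.
exists (P + P`_n *: (S * 'X^(n - m) - 'X^n)); split.
- move=> i; rewrite coefD coefZ; apply: subringD => //; apply: subringM => //.
  by apply: coefs_inB => //; [apply: coefs_inM => //|]; exact: coefs_inX.
- apply/leq_sizeP => j nj; rewrite coefD coefZ coefB coefMXn coefXn coef_poly.
  have -> : (j < n - m)%N = false by apply/negbTE; rewrite -leqNgt; lia.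
  have -> : (j - (n - m) < m)%N = false by apply/negbTE; rewrite -leqNgt; lia.
  case: eqVneq => [->|jn]; first by rewrite sub0r mulrN1 subrr.
  by rewrite subr0 mulr0 addr0 nth_default // (leq_trans sP) // ltn_neqAle eq_sym jn.
- rewrite !(hornerE, hornerXn) eS eP -exprD subnKC // subrr mulr0 addr0 //.
Qed.

(** If neither [x] nor [x^-1] lies in [A], both adjunctions contain [pi^-1]. Of the two resulting
    relations the one of larger degree can always be shortened; the descent on the total degree ends
    with [pi^-1] in [A]. *)
Lemma max_valuation (K : fieldType) (pi : K) (A : set K) x :
  max_avoiding pi^-1 A -> A pi -> A x \/ A x^-1.
Proof.
move=> Am Api; have [Ar Ac _] := Am.
have [x0|x0] := eqVneq x 0; first by left; rewrite x0; exact: subring0.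
apply: contrapT => /not_orP[Ax Axi].
suff main k : forall n m P Q, (n + m <= k)%N ->
    coefs_in A P -> (size P <= n.+1)%N -> P.[x] = pi^-1 ->
    coefs_in A Q -> (size Q <= m.+1)%N -> Q.[x^-1] = pi^-1 -> False.
  have [P AP eP] := max_adjoin Am Ax; have [Q AQ eQ] := max_adjoin Am Axi.
  exact: (main _ (size P) (size Q) P Q (leqnn _) AP (leqnSn _) (esym eP) AQ (leqnSn _)).
elim: k => [|k IH] n m P Q nmk AP sP eP AQ sQ eQ.
  apply: Ac; rewrite -eP (size1_polyC (leq_trans sP _)) ?hornerC //; lia.
have [mn|/ltnW nm] := leqP m n.
- have [P' [AP' sP' eP']] := reduce_degree Am Api x0 mn AP sP eP AQ sQ eQ.
  case: n => [|n] in mn nmk sP sP' *.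
    by apply: Ac; rewrite -eP (size1_polyC sP) hornerC.
  by apply: (IH n m P' Q) => //; lia.
- have := @reduce_degree K pi A x^-1 m n Q P.
  rewrite invrK invr_eq0 => /(_ Am Api x0 nm AQ sQ eQ AP sP eP) [Q' [AQ' sQ' eQ']].
  case: m => [|m] in nm nmk sQ sQ' *.
    by apply: Ac; rewrite -eQ (size1_polyC sQ) hornerC.
  by apply: (IH n m P Q') => //; lia.
Qed.

(** * Units of a valuation ring and comparison of sizes *)

Definition val_unit (K : fieldType) (A : set K) (x : K) : Prop :=
  [/\ x != 0, A x & A x^-1].

Lemma val_unit1 (K : fieldType) (A : set K) : is_subring A -> val_unit A 1.
Proof. by move=> [A1 _]; split; rewrite ?oner_neq0 ?invr1. Qed.

Lemma val_unitM (K : fieldType) (A : set K) x y :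
  is_subring A -> val_unit A x -> val_unit A y -> val_unit A (x * y).
Proof.
move=> Ar [x0 Ax Axi] [y0 Ay Ayi]; split; first by rewrite mulf_neq0.
  exact: subringM.
by rewrite invfM; exact: subringM.
Qed.

Lemma val_unitV (K : fieldType) (A : set K) x :
  val_unit A x -> val_unit A x^-1.
Proof. by move=> [x0 Ax Axi]; split; rewrite ?invrK ?invr_eq0. Qed.

Lemma val_unitX (K : fieldType) (A : set K) x n :
  is_subring A -> val_unit A x -> val_unit A (x ^+ n).
Proof.
move=> Ar Ux; elim: n => [|n IH]; first by rewrite expr0; exact: val_unit1.
by rewrite exprS; exact: val_unitM.
Qed.

(** The ultrametric principle before any absolute value is available: two terms of different size
    add up to something of the size of the larger one. *)
Lemma val_unit_add (K : fieldType) (A : set K) a b :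
  is_subring A -> (forall x, A x \/ A x^-1) -> a != 0 -> b != 0 ->
  ~ val_unit A (a / b) -> val_unit A ((a + b) / a) \/ val_unit A ((a + b) / b).
Proof.
move=> Ar Av.
have main c d : c != 0 -> d != 0 -> ~ val_unit A (c / d) -> A (c / d) ->
    val_unit A ((c + d) / d).
  move=> c0 d0 nU Acd; have A1 : A 1 by case: Ar.
  have e : (c + d) / d = c / d + 1 by rewrite mulrDl mulfV.
  have Ae : A (c / d + 1) by exact: subringD.
  have nz : c / d + 1 != 0.
    apply/eqP => /eqP; rewrite addr_eq0 => /eqP e1; apply: nU; rewrite e1.
    by split; rewrite ?invrN ?invr1 ?oppr_eq0 ?oner_neq0 // -[- 1]add0r;
       apply: subringB => //; exact: subring0.
  rewrite e; split => //; set t := c / d in nU Acd nz *.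
  have t0 : t != 0 by rewrite mulf_neq0 ?invr_eq0.
  have [Atf|] := Av (t / (t + 1)).
    rewrite (_ : (t + 1)^-1 = 1 - t / (t + 1)); first exact: subringB.
    by field.
  rewrite invf_div => Aft; exfalso; apply: nU; split => //.
  rewrite (_ : t^-1 = (t + 1) / t - 1); first exact: subringB.
  by field.
move=> a0 b0 nU; have [Aab|] := Av (a / b); first by right; exact: main.
rewrite invf_div => Aba; left; rewrite addrC; apply: main => // Uba.
by apply: nU; rewrite -invf_div; exact: val_unitV.
Qed.

(** If no two nonzero terms had the same size, every partial sum would have the size of one of its
    terms, and the total could not vanish. *)
Lemma val_unit_sum (K : fieldType) (A : set K) n (t : nat -> K) :
  is_subring A -> (forall x, A x \/ A x^-1) ->
  \sum_(i < n) t i = 0 -> (exists2 i, (i < n)%N & t i != 0) ->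
  exists i j, [/\ (i < j < n)%N, t i != 0, t j != 0 & val_unit A (t i / t j)].
Proof.
move=> Ar Av s0 tn0; apply: contrapT => nex.
suff main k : (k <= n)%N -> (forall i, (i < k)%N -> t i = 0) \/
    exists i, [/\ (i < k)%N, t i != 0 & val_unit A ((\sum_(i < k) t i) / t i)].
  have [z|[i [_ _ [+ _ _]]]] := main n (leqnn n).
    by case: tn0 => i /z ->; rewrite eqxx.
  by rewrite s0 mul0r eqxx.
elim: k => [_|k IH kn]; first by left.
have [tk0|tk0] := eqVneq (t k) 0.
  have [z|[i [ik ti0 Ui]]] := IH (ltnW kn); [left|right].
    by move=> i; rewrite ltnS leq_eqVlt => /predU1P[->//|]; exact: z.
  by exists i; split => //; [exact: ltnW | rewrite big_ord_recr /= tk0 addr0].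
right; have [z|[i [ik ti0 Ui]]] := IH (ltnW kn).
  exists k; split => //; rewrite big_ord_recr /= big1 ?add0r ?mulfV //.
    exact: val_unit1.
  by move=> i _; exact: z.
set S := \sum_(i < k) t i in Ui.
have S0 : S != 0 by case: Ui => + _ _; rewrite mulf_eq0 => /norP[].
have [] := @val_unit_add K A S (t k) Ar Av S0 tk0.
- move=> USk; apply: nex; exists i, k; split => //; first by rewrite ik.
  rewrite (_ : t i / t k = (S / t i)^-1 * (S / t k)); last by field; rewrite ti0 tk0.
  by apply: val_unitM => //; exact: val_unitV.
- move=> U; exists i; split => //; first exact: ltnW.
  rewrite big_ord_recr /= -/S.
  rewrite (_ : (S + t k) / t i = (S + t k) / S * (S / t i)); last by field; rewrite ti0 S0.
  exact: val_unitM.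
- by move=> U; exists k; split => //; rewrite big_ord_recr.
Qed.

(* The valuation of [pi] is normalised to [-1], so that [p ^ l] is the absolute value. *)
Definition log_val (R : realType) (K : fieldType) (A : set K) (pi x : K) (l : R) : Prop :=
  exists n a b : nat, [/\ (0 < n)%N, val_unit A (x ^+ n * pi ^+ a / pi ^+ b) &
    l = (a%:R - b%:R) / n%:R].

Definition val_ring (K : fieldType) (A : set K) (pi : K) : Prop :=
  [/\ is_subring A, forall x, A x \/ A x^-1, A pi & ~ A pi^-1].

Lemma val_ring_pi0 (K : fieldType) (A : set K) pi : val_ring A pi -> pi != 0.
Proof.
by move=> [Ar _ _ Ac]; apply/eqP => pi0; apply: Ac; rewrite pi0 invr0; exact: subring0.
Qed.

Lemma val_ring_root (K : fieldType) (A : set K) pi x n :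
  val_ring A pi -> (0 < n)%N -> A (x ^+ n) -> A x.
Proof.
move=> [Ar Av _ _]; case: n => // n _ Axn.
have [x0|x0] := eqVneq x 0; first by rewrite x0; exact: subring0.
have [//|Axi] := Av x.
rewrite (_ : x = x ^+ n.+1 * x^-1 ^+ n); first by apply: subringM => //; exact: subringX.
by rewrite exprS exprVn mulfK // expf_neq0.
Qed.

Lemma val_ring_pow (K : fieldType) (A : set K) pi a b :
  val_ring A pi -> A (pi ^+ b / pi ^+ a) -> (a <= b)%N.
Proof.
move=> Avr Aba; have pi0 := val_ring_pi0 Avr; have [Ar _ Api Ac] := Avr.
rewrite leqNgt; apply/negP => ba; apply: Ac.
rewrite (_ : pi^-1 = pi ^+ b / pi ^+ a * pi ^+ (a - b).-1).
  by apply: subringM => //; exact: subringX.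
have -> : pi ^+ a = pi ^+ (a - b).-1 * pi * pi ^+ b.
  by rewrite -exprSr -exprD; congr (_ ^+ _); lia.
by field; rewrite !expf_neq0 // pi0.
Qed.

(** A valuation ring is integrally closed, so membership can be tested on the [n]-th power, which is
    a unit times a power of [pi]. *)
Lemma log_val_le0 (R : realType) (K : fieldType) (A : set K) pi x (l : R) :
  val_ring A pi -> log_val A pi x l -> A x <-> l <= 0.
Proof.
move=> Avr; have pi0 := val_ring_pi0 Avr; have [Ar _ Api _] := Avr.
move=> [n [a [b [n0 [u0 Au Aui] ->]]]].
rewrite pmulr_lle0 ?invr_gt0 ?ltr0n // subr_le0 ler_nat.
have x0 : x != 0.
  by apply: contra_neq u0 => ->; rewrite expr0n eqn0Ngt n0 mul0r mul0r.
split=> [Ax|ab].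
  apply: (val_ring_pow Avr).
  rewrite (_ : _ / _ = x ^+ n * (x ^+ n * pi ^+ a / pi ^+ b)^-1).
    by apply: subringM => //; exact: subringX.
  by field; rewrite !expf_neq0.
apply: (val_ring_root Avr n0).
rewrite (_ : x ^+ n = x ^+ n * pi ^+ a / pi ^+ b * pi ^+ (b - a)).
  by apply: subringM => //; exact: subringX.
rewrite -{1}(subnK ab) exprD.
by field; rewrite !expf_neq0.
Qed.

Lemma log_valM (R : realType) (K : fieldType) (A : set K) pi x y (l m : R) :
  val_ring A pi -> log_val A pi x l -> log_val A pi y m ->
  log_val A pi (x * y) (l + m).
Proof.
move=> Avr; have pi0 := val_ring_pi0 Avr; have [Ar _ Api _] := Avr.
move=> [n [a [b [n0 Ux ->]]]] [n' [a' [b' [n'0 Uy ->]]]].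
exists (n * n')%N, (a * n' + a' * n)%N, (b * n' + b' * n)%N; split.
- by rewrite muln_gt0 n0.
- have := val_unitM Ar (val_unitX n' Ar Ux) (val_unitX n Ar Uy).
  congr val_unit; rewrite !exprMn !exprVn !exprD -!exprM (mulnC n' n).
  by field; rewrite !expf_neq0.
- by rewrite !natrD !natrM; field; rewrite !pnatr_eq0 -!lt0n n0 n'0.
Qed.

Lemma log_valV (R : realType) (K : fieldType) (A : set K) pi x (l : R) :
  val_ring A pi -> log_val A pi x l -> log_val A pi x^-1 (- l).
Proof.
move=> Avr; have pi0 := val_ring_pi0 Avr.
move=> [n [a [b [n0 Ux ->]]]]; exists n, b, a; split => //.
- have := val_unitV Ux; congr val_unit.
  have x0 : x != 0.
    case: Ux => + _ _; apply: contra_neq => ->.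
    by rewrite expr0n eqn0Ngt n0 mul0r mul0r.
  by rewrite exprVn; field; rewrite !expf_neq0.
- by rewrite -mulNr opprB.
Qed.

Lemma log_val_neq0 (R : realType) (K : fieldType) (A : set K) pi x (l : R) :
  log_val A pi x l -> x != 0.
Proof.
move=> [n [a [b [n0 [+ _ _] _]]]]; apply: contra_neq => ->.
by rewrite expr0n eqn0Ngt n0 mul0r mul0r.
Qed.

(** The quotient [x / x = 1] lies in [A] and has both logarithms [l - m] and [m - l], so neither is
    positive. *)
Lemma log_val_uniq (R : realType) (K : fieldType) (A : set K) pi x (l m : R) :
  val_ring A pi -> log_val A pi x l -> log_val A pi x m -> l = m.
Proof.
move=> Avr xl xm; have A1 : A 1 by case: Avr => -[].
have x0 := log_val_neq0 xl.
have := log_valM Avr xl (log_valV Avr xm); have := log_valM Avr xm (log_valV Avr xl).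
rewrite mulfV // => /(log_val_le0 Avr)[+ _] /(log_val_le0 Avr)[+ _].
move=> /(_ A1) + /(_ A1); lra.
Qed.

Lemma max_avoiding_val_ring (K : fieldType) (pi : K) (A : set K) :
  max_avoiding pi^-1 A -> A pi -> val_ring A pi.
Proof.
move=> Am Api; have [Ar Ac _] := Am.
by split => // x; exact: (max_valuation x Am Api).
Qed.

(** * Valuation rings above a prime and the resulting absolute value *)

Lemma exists_val_ring (p : nat) : prime p -> exists A : set algC, val_ring A p%:R.
Proof.
(* The maximal subring is grown from the integers, among which [1 / p] does not occur. *)
move=> pp; pose Z := [set x : algC | exists n : int, x = n%:~R].
have Zr : is_subring Z.
  split; first by exists 1.
  by move=> _ _ [m ->] [n ->]; split; [exists (m - n); rewrite rmorphB|exists (m * n); rewrite rmorphM].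
have [|A Am] := @exists_max_subring algC (p%:R)^-1 Z Zr.
  move=> [n en]; have : p%:Z * n = 1.
    apply/eqP; rewrite -(eqr_int algC) rmorphM /= -en mulfV // pnatr_eq0.
    by case: p pp {en}.
  move=> /(congr1 absz); rewrite abszM /= => /eqP; rewrite muln_eq1 => /andP[/eqP p1].
  by rewrite p1 in pp.
exists A; apply: max_avoiding_val_ring => //.
by apply: subring_nat; case: Am.
Qed.

(** Either [t = pi * y / (1 + pi * y)] lies in [A], and then so does [1 - t], the inverse sought, or
    [t^-1] does, which would put [pi^-1] into [A]. *)
Lemma val_ring_radical (K : fieldType) (A : set K) pi y :
  val_ring A pi -> A y -> val_unit A (1 + pi * y).
Proof.
move=> Avr Ay; have pi0 := val_ring_pi0 Avr; have [Ar Av Api Ac] := Avr.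
have A1 : A 1 by case: Ar.
have Nz : 1 + pi * y != 0.
  apply/eqP => /eqP; rewrite addr_eq0 eq_sym eqr_oppLR => /eqP e; apply: Ac.
  rewrite (_ : pi^-1 = 0 - y); first by apply: subringB => //; exact: subring0.
  by apply: (mulfI pi0); rewrite mulfV // sub0r mulrN e opprK.
have Au : A (1 + pi * y) by apply: subringD => //; exact: subringM.
split => //; have [->|y0] := eqVneq y 0; first by rewrite mulr0 addr0 invr1.
have py0 : pi * y != 0 by rewrite mulf_neq0.
have [At|] := Av (pi * y / (1 + pi * y)).
  rewrite (_ : _^-1 = 1 - pi * y / (1 + pi * y)); first exact: subringB.
  by field.
rewrite invf_div => At; exfalso; apply: Ac.
rewrite (_ : pi^-1 = ((1 + pi * y) / (pi * y) - 1) * y).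
  by apply: subringM => //; exact: subringB.
by field; rewrite y0 pi0.
Qed.

(** By Bezout some multiple of [m] has the form [1 + p * v], which is a unit. *)
Lemma val_unit_nat (A : set algC) (p m : nat) :
  val_ring A p%:R -> (0 < m)%N -> coprime p m -> val_unit A m%:R.
Proof.
move=> Avr m0; rewrite coprime_sym => /(coprimeP _ m0)[[u v] /= uv].
have [Ar _ _ _] := Avr.
have e : (u * m = 1 + p * v)%N by rewrite [(p * v)%N]mulnC; lia.
have [_ _ U] : val_unit A (u * m)%:R.
  by rewrite e natrD natrM; apply: val_ring_radical => //; exact: subring_nat.
split; [by rewrite pnatr_eq0 -lt0n|exact: subring_nat|].
rewrite (_ : m%:R^-1 = u%:R * (u * m)%:R^-1).
  by apply: subringM => //; exact: subring_nat.
rewrite natrM invfM mulVKf // pnatr_eq0; apply/eqP => u0; move: e; rewrite u0.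
by rewrite mul0n add1n.
Qed.

Lemma val_unit_rat (A : set algC) (p : nat) (q : rat) :
  prime p -> val_ring A p%:R -> q != 0 ->
  val_unit A (ratr q * p%:R ^+ logn p `|denq q| / p%:R ^+ logn p `|numq q|).
Proof.
move=> pp Avr q0; have [Ar _ _ _] := Avr; have p0 := val_ring_pi0 Avr.
have n0 : (0 < `|numq q|)%N by rewrite absz_gt0 numq_eq0.
have d0 : (0 < `|denq q|)%N by rewrite absz_gt0 denq_eq0.
have [m cm em] := pfactor_coprime pp n0; have [m' cm' em'] := pfactor_coprime pp d0.
have m0 : (0 < m)%N by move: n0; rewrite em; case: m {cm em}.
have m'0 : (0 < m')%N by move: d0; rewrite em'; case: m' {cm' em'}.
set a := logn _ _ in em' *; set b := logn _ _ in em *.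
have -> : ratr q * p%:R ^+ a / p%:R ^+ b = (-1) ^+ (numq q < 0)%R * (m%:R / m'%:R) :> algC.
  rewrite /ratr {1}[numq q]intEsign em -[denq q]gez0_abs ?denq_ge0 // em'.
  rewrite rmorphM rmorphXn rmorphN1 !PoszM !rmorphM /= -!pmulrn !natrX.
  by field; rewrite !expf_neq0 ?pnatr_eq0 -?lt0n ?m'0 ?prime_gt0.
apply: val_unitM => //.
  apply: val_unitX => //; split; rewrite ?invrN ?invr1 ?oppr_eq0 ?oner_eq0 //.
    by rewrite -sub0r; apply: subringB => //; [exact: subring0|case: Ar].
  by rewrite -sub0r; apply: subringB => //; [exact: subring0|case: Ar].
apply: val_unitM => //; first exact: (val_unit_nat Avr).
by apply: val_unitV; exact: (val_unit_nat Avr).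
Qed.

Lemma log_val_rat (R : realType) (A : set algC) (p : nat) (q : rat) :
  prime p -> val_ring A p%:R -> q != 0 ->
  log_val A p%:R (ratr q) ((logn p `|denq q|)%:R - (logn p `|numq q|)%:R : R).
Proof.
move=> pp Avr q0; exists 1%N, (logn p `|denq q|), (logn p `|numq q|).
by split => //; rewrite ?expr1 ?divr1 //; exact: val_unit_rat.
Qed.

(** The minimal polynomial gives a vanishing sum of terms [a_i * x ^+ i]. Two of them have the same
    size, so a power of [x] has the size of a rational number, and the size of the latter is read
    off from its factorisation. *)
Lemma log_val_exists (R : realType) (A : set algC) (p : nat) (x : algC) :
  prime p -> val_ring A p%:R -> x != 0 -> exists l : R, log_val A p%:R x l.
Proof.
move=> pp Avr x0; have [Ar Av _ _] := Avr.
have [P [eP Pmon] _] := minCpolyP x.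
have := root_minCpoly x; rewrite eP => /rootP; rewrite horner_coef size_map_poly => s0.
have [|i [j [/andP[ij _] ti tj U]]] := @val_unit_sum _ A _ (fun i => (map_poly ratr P)`_i * x ^+ i) Ar Av s0.
  (* The leading term is nonzero since [P] is monic and [x] is nonzero. *)
  exists (size P).-1; first by rewrite prednK // size_poly_gt0 monic_neq0.
  rewrite coef_map /= -/(lead_coef P) (monicP Pmon) rmorph1 mul1r.
  by rewrite expf_neq0.
have nz k : (map_poly ratr P)`_k * x ^+ k != 0 -> P`_k != 0.
  by apply: contra_neq => e; rewrite coef_map e raddf0 mul0r.
have Pi0 := nz _ ti; have Pj0 := nz _ tj; move: U; rewrite !coef_map /= => U.
have Uq : val_unit A (ratr (P`_i / P`_j) * x ^- (j - i)).
  have -> : ratr (P`_i / P`_j) * x ^- (j - i) = ratr P`_i * x ^+ i / (ratr P`_j * x ^+ j) => //.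
  have -> : x ^+ j = x ^+ (j - i) * x ^+ i by rewrite -exprD subnK // ltnW.
  rewrite fmorph_div /=.
  by field; rewrite fmorph_eq0 Pj0 !expf_neq0.
have q0 : P`_i / P`_j != 0 by rewrite mulf_neq0 ?invr_eq0.
have Up := val_unit_rat pp Avr q0.
set q := P`_i / P`_j in Uq q0 Up.
eexists; exists (j - i)%N, (logn p `|denq q|), (logn p `|numq q|); split => //.
  by rewrite subn_gt0.
set u := _ / _ in Up.
rewrite (_ : _ / _ = u * (ratr q * x ^- (j - i))^-1).
  by apply: val_unitM => //; exact: val_unitV.
rewrite /u; field; rewrite !expf_neq0 ?(val_ring_pi0 Avr) //=.
by rewrite fmorph_eq0 q0.
Qed.

(** [absv] is a choice with the zero function as default, so the place 3 contributes to the height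
    only once an extension is constructed. It is [p] raised to the logarithm [log_val]; the triangle
    inequality follows from [x + y = x * (1 + y / x)] when [y / x] lies in [A]. *)
Lemma exists_extends_place (R : realType) (p : nat) :
  prime p -> exists w : algC -> R, extends_place (Some p) w.
Proof.
move=> pp; have [A Avr] := exists_val_ring pp; have [Ar Av _ _] := Avr.
pose L x : R := xget 0 [set l | log_val A p%:R x l].
have LP x : x != 0 -> log_val A p%:R x (L x).
  by move=> x0; apply: xgetPex; exact: log_val_exists.
pose w x : R := if x == 0 then 0 else p%:R `^ L x.
have p1 : 1 <= p%:R :> R by rewrite ler1n prime_gt0.
have p0 : p%:R != 0 :> R by rewrite pnatr_eq0 -lt0n prime_gt0.
have w_ge0 x : 0 <= w x by rewrite /w; case: eqP => // _; exact: powR_ge0.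
have w_eq0 x : w x = 0 <-> x = 0.
  rewrite /w; case: eqVneq => // x0; split=> [/powR_eq0_eq0|/eqP]; last by rewrite (negbTE x0).
  by move/eqP; rewrite (negbTE p0).
have wM : {morph w : a b / a * b}.
  move=> x y; rewrite /w; have [->|x0] := eqVneq x 0; first by rewrite !mul0r eqxx.
  have [->|y0] := eqVneq y 0; first by rewrite !mulr0 eqxx.
  rewrite mulf_eq0 (negbTE x0) (negbTE y0) /= -powRD; last by rewrite p0 implybT.
  congr (_ `^ _); have xy0 : x * y != 0 by rewrite mulf_neq0.
  exact: (log_val_uniq Avr (LP _ xy0) (log_valM Avr (LP _ x0) (LP _ y0))).
have wA x : A x -> w x <= 1.
  rewrite /w; case: eqVneq => [_ _|x0 Ax]; first exact: ler01.
  by rewrite -[leRHS](powRr0 p%:R); apply: ler_powR => //; exact/(log_val_le0 Avr (LP _ x0)).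
have wD x y : x != 0 -> A (y / x) -> w (x + y) <= w x + w y.
  move=> x0 Ayx; rewrite (_ : x + y = x * (1 + y / x)); last by field.
  rewrite wM; apply: (@le_trans _ _ (w x)); last by rewrite lerDl.
  by rewrite ler_piMr // wA //; apply: subringD => //; case: Ar.
exists w; split => //.
- move=> x y; have [->|x0] := eqVneq x 0; first by rewrite add0r lerDr.
  have [->|y0] := eqVneq y 0; first by rewrite addr0 lerDl.
  have [|] := Av (y / x); first exact: wD.
  by rewrite invf_div addrC [w x + _]addrC; exact: wD.
- move=> q; rewrite /absQ /w fmorph_eq0; case: eqVneq => // q0.
  have rq0 : ratr q != 0 :> algC by rewrite fmorph_eq0.
  rewrite (log_val_uniq Avr (LP _ rq0) (log_val_rat R pp Avr q0)).
  rewrite powRB; last by rewrite p0 implybT.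
  by rewrite !powR_mulrn ?ler0n // !natrX.
Qed.

(** * Non-archimedean absolute values on algebraic numbers *)

(** Bernoulli's inequality. *)
Lemma expr_ge_linear (R : realFieldType) (x : R) n :
  -1 <= x -> 1 + n%:R * x <= (1 + x) ^+ n.
Proof.
move=> x1; elim: n => [|n IH]; first by rewrite expr0 mul0r addr0.
rewrite exprS; apply: le_trans (_ : (1 + x) * (1 + n%:R * x) <= _); last first.
  by apply: ler_wpM2l => //; lra.
rewrite -natr1 (_ : (1 + x) * _ = 1 + (n%:R + 1) * x + n%:R * x ^+ 2); last by ring.
by rewrite lerDl mulr_ge0 ?ler0n ?sqr_ge0.
Qed.

Lemma expr_le_linear (R : archiRealFieldType) (r : R) :
  (forall n : nat, r ^+ n <= n.+1%:R) -> r <= 1.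
Proof.
move=> rn; rewrite leNgt; apply/negP => r1; pose e := r - 1.
have e0 : 0 < e by rewrite subr_gt0.
(* With [n * e ^+ 2 > 2], the square of Bernoulli's bound for [r ^+ n] exceeds [2 * n + 1], the
   bound assumed for [r ^+ (2 * n)]. *)
pose n := Num.bound (2 / e ^+ 2).
have nb : 2 / e ^+ 2 < n%:R by apply: archi_boundP; rewrite divr_ge0 ?sqr_ge0.
rewrite ltr_pdivrMr ?exprn_gt0 // in nb.
have ge1 : 1 + n%:R * e <= r ^+ n.
  by have := @expr_ge_linear _ e n; rewrite /e addrCA subrr addr0; apply; lra.
have := rn (n * 2)%N; rewrite exprM -natr1 natrM.
have n0 : 0 <= n%:R :> R by rewrite ler0n.
have : (1 + n%:R * e) ^+ 2 <= (r ^+ n) ^+ 2.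
  by rewrite lerXn2r ?nnegrE ?exprn_ge0 ?addr_ge0 ?mulr_ge0 ?(ltW e0) ?(le_trans ler01 (ltW r1)).
have : 2 * n%:R <= n%:R * e ^+ 2 * n%:R by apply: ler_wpM2r => //; exact: ltW.
have : 0 <= n%:R * e by rewrite mulr_ge0 // ltW.
rewrite !expr2; nra.
Qed.

Lemma place_ge0 (R : realType) v (w : algC -> R) a : extends_place v w -> 0 <= w a.
Proof. by move=> [+ _ _ _] => /(_ a)[]. Qed.

Lemma place_eq0 (R : realType) v (w : algC -> R) a :
  extends_place v w -> (w a == 0) = (a == 0).
Proof. by move=> [+ _ _ _] => /(_ a)[_ e]; apply/eqP/eqP => /e. Qed.

Lemma place_gt0 (R : realType) v (w : algC -> R) a :
  extends_place v w -> a != 0 -> 0 < w a.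
Proof. by move=> wP a0; rewrite lt_def (place_eq0 _ wP) a0 (place_ge0 _ wP). Qed.

Lemma placeM (R : realType) v (w : algC -> R) a b :
  extends_place v w -> w (a * b) = w a * w b.
Proof. by move=> [_ + _ _]; exact. Qed.

Lemma place0 (R : realType) v (w : algC -> R) : extends_place v w -> w 0 = 0.
Proof. by move=> wP; apply/eqP; rewrite (place_eq0 _ wP). Qed.

Lemma place1 (R : realType) v (w : algC -> R) : extends_place v w -> w 1 = 1.
Proof.
move=> wP; have w1 : w 1 != 0 by rewrite (place_eq0 _ wP) oner_eq0.
by apply: (mulfI w1); rewrite -(placeM _ _ wP) !mulr1.
Qed.

Lemma placeX (R : realType) v (w : algC -> R) a n :
  extends_place v w -> w (a ^+ n) = w a ^+ n.
Proof.
move=> wP; elim: n => [|n IH]; first by rewrite !expr0 (place1 wP).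
by rewrite !exprS (placeM _ _ wP) IH.
Qed.

Lemma placeV (R : realType) v (w : algC -> R) a :
  extends_place v w -> w a^-1 = (w a)^-1.
Proof.
move=> wP; have [->|a0] := eqVneq a 0; first by rewrite invr0 (place0 wP) invr0.
have w0 : w a != 0 by rewrite (place_eq0 _ wP).
by apply: (mulfI w0); rewrite -(placeM _ _ wP) !mulfV // (place1 wP).
Qed.

Lemma placeN (R : realType) v (w : algC -> R) a :
  extends_place v w -> w (- a) = w a.
Proof.
move=> wP; rewrite -mulN1r (placeM _ _ wP).
suff -> : w (-1) = 1 by rewrite mul1r.
apply/eqP; rewrite -(@eqrXn2 _ 2) ?ler01 ?(place_ge0 _ wP) //.
by rewrite -(placeX _ _ wP) sqrrN !expr1n (place1 wP).
Qed.

Lemma place_nat (R : realType) p (w : algC -> R) n :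
  extends_place (Some p) w -> (0 < n)%N -> w n%:R = (p ^ logn p n)%:R^-1.
Proof.
move=> [_ _ _ wq] n0; have := wq n%:R; rewrite ratr_nat => ->; rewrite /absQ.
rewrite pnatr_eq0 -[n == 0%N]negbK -lt0n n0 /= -[n%:R]/(n%:Q) pmulrn numq_int denq_int.
by rewrite /= logn1 expn0 mul1r.
Qed.

Lemma place_nat_le1 (R : realType) p (w : algC -> R) n :
  extends_place (Some p) w -> w n%:R <= 1.
Proof.
move=> wP; case: n => [|n]; first by rewrite (place0 wP) ler01.
by rewrite (place_nat wP) // invf_le1 ?ler1n ?ltr0n pfactor_gt0.
Qed.

Lemma place_sum (R : realType) v (w : algC -> R) (I : Type) (r : seq I) (F : I -> algC) :
  extends_place v w -> w (\sum_(i <- r) F i) <= \sum_(i <- r) w (F i).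
Proof.
move=> wP; have [_ _ wD _] := wP.
elim/big_rec2: _ => [|i x y _ yx]; first by rewrite (place0 wP).
by apply: le_trans (wD _ _) _; rewrite lerD2l.
Qed.

(* [|a + b|^n <= (n + 1) max(|a|, |b|)^n] since binomial coefficients have absolute value at most 1. *)
Lemma place_ultra (R : realType) p (w : algC -> R) a b M :
  extends_place (Some p) w -> w a <= M -> w b <= M -> w (a + b) <= M.
Proof.
move=> wP aM bM; have M0 : 0 <= M by exact: le_trans (place_ge0 a wP) aM.
have [M00|Mn0] := eqVneq M 0.
  have [_ _ wD _] := wP; apply: le_trans (wD _ _) _.
  by rewrite M00 in aM bM *; lra.
have Mp : 0 < M by rewrite lt_def Mn0.
rewrite -[M]mul1r -ler_pdivrMr //; apply: expr_le_linear => n.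
rewrite expr_div_n ler_pdivrMr ?exprn_gt0 // -(placeX _ _ wP) exprDn.
apply: le_trans (place_sum _ _ wP) _.
apply: le_trans (_ : \sum_(i < n.+1) M ^+ n <= _); last first.
  by rewrite sumr_const card_ord mulr_natl.
apply: ler_sum => i _; rewrite -mulr_natr !(placeM _ _ wP) !(placeX _ _ wP).
rewrite -[leRHS]mulr1; apply: ler_pM; rewrite ?mulr_ge0 ?exprn_ge0 ?(place_ge0 _ wP) //.
  have -> : M ^+ n = M ^+ (n - i) * M ^+ i by rewrite -exprD subnK // -ltnS.
  by apply: ler_pM; rewrite ?exprn_ge0 ?(place_ge0 _ wP) // lerXn2r ?nnegrE ?(place_ge0 _ wP).
exact: place_nat_le1 wP.
Qed.

Lemma place_ultra_eq (R : realType) p (w : algC -> R) a b :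
  extends_place (Some p) w -> w a < w b -> w (a + b) = w b.
Proof.
move=> wP ab; apply/eqP; rewrite eq_le (place_ultra wP) ?(ltW ab) //=.
rewrite leNgt; apply/negP => lt.
have : w (a + b + - a) <= Num.max (w (a + b)) (w a).
  by apply: (place_ultra wP); rewrite ?(placeN _ wP) le_max lexx ?orbT.
by rewrite addrAC subrr add0r leNgt gt_max lt ab.
Qed.

Lemma place_ultra_sum (R : realType) p (w : algC -> R) (I : Type) (r : seq I) (F : I -> algC) M :
  extends_place (Some p) w -> 0 <= M -> (forall i, w (F i) <= M) ->
  w (\sum_(i <- r) F i) <= M.
Proof.
move=> wP M0 FM; elim/big_ind: _ => [|x y|//]; first by rewrite (place0 wP).
exact: place_ultra wP.
Qed.

(* Only the primes dividing a denominator of the minimal polynomial matter. *)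
Lemma place_integral (R : realType) (x : algC) :
  exists2 N, (0 < N)%N & forall p (w : algC -> R), prime p -> ~~ (p %| N)%N ->
    extends_place (Some p) w -> w x <= 1.
Proof.
have [P [eP Pmon] _] := minCpolyP x.
have := root_minCpoly x; rewrite eP => /rootP; rewrite horner_coef size_map_poly => s0.
exists (\prod_(i < size P) `|denq P`_i|)%N.
  by rewrite prodn_gt0 // => i; rewrite absz_gt0 denq_eq0.
move=> p w pp pN wP; rewrite leNgt; apply/negP => x1.
have sP : (0 < size P)%N by rewrite size_poly_gt0 monic_neq0.
have wc i : w (ratr P`_i) <= 1.
  have [iP|iP] := ltnP i (size P); last first.
    by rewrite nth_default // raddf0 (place0 wP) ler01.
  have [_ _ _ ->] := wP; rewrite /absQ; case: eqP => _; first exact: ler01.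
  have -> : logn p `|denq P`_i| = 0%N.
    rewrite logn_coprime // prime_coprime //; apply: contra pN => pd.
    by rewrite (bigD1 (Ordinal iP)) //= dvdn_mulr.
  by rewrite expn0 mul1r invf_le1 ?ler1n ?ltr0n expn_gt0 prime_gt0.
case e : (size P) sP s0 => [//|n] _.
have lc : P`_n = 1 by rewrite -(monicP Pmon) /lead_coef e.
rewrite big_ord_recr /= (coef_map ratr) /= lc rmorph1 mul1r => /eqP; rewrite addrC addr_eq0 => /eqP xn.
have := congr1 w xn; rewrite (placeX _ _ wP) (placeN _ wP).
case: n e xn lc => [|n] e xn lc.
  by rewrite big_ord0 (place0 wP) expr0 => /eqP; rewrite oner_eq0.
(* For [|x| > 1] the lower terms of the monic relation have size at most [|x|^n], too small to
   cancel [x ^+ n.+1]. *)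
have : w (\sum_(i < n.+1) (map_poly ratr P)`_i * x ^+ i) <= w x ^+ n.
  apply: (@place_ultra_sum _ _ _ _ _ (fun i : 'I_n.+1 => (map_poly ratr P)`_i * x ^+ i) _ wP); first by rewrite exprn_ge0 // (place_ge0 _ wP).
  move=> i; rewrite coef_map (placeM _ _ wP) (placeX _ _ wP) -[leRHS]mul1r.
  apply: ler_pM; rewrite ?exprn_ge0 ?(place_ge0 _ wP) //.
  exact: wc.
by rewrite (ler_eXn2l x1) -ltnS.
move=> le e2; move: le; rewrite -e2 exprS ger_pMl ?exprn_gt0 ?(lt_trans ltr01) //.
by rewrite leNgt x1.
Qed.

(** * The 3-adic size of a backward orbit *)

(** Two consecutive terms are carried along because the recursion has order two. The initial values
    are the logarithms of [|s 2|_3] and [|s 3|_3] for a backward orbit [s]: the first comes from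
    [|s 2|^2 = 1 / |1/2 - b|] with [|1/2 - b|^2 = 1/3], the second from [|s 3| = |s 2|^2]. *)
Fixpoint log_growth (R : realType) (n : nat) : R * R :=
  if n is n'.+1 then
    let: (x, y) := log_growth R n' in (y, 2 * y - x / 2)
  else (ln 3 / 4, ln 3 / 2).

Definition growth (R : realType) (n : nat) : R := (log_growth R n).1.

Lemma growth0 (R : realType) : growth R 0 = ln 3 / 4. Proof. by []. Qed.

Lemma growth1 (R : realType) : growth R 1 = ln 3 / 2. Proof. by []. Qed.

Lemma growthSS (R : realType) n :
  growth R n.+2 = 2 * growth R n.+1 - growth R n / 2.
Proof. by rewrite /growth /=; case: (log_growth R n). Qed.

Lemma ln3_gt0 (R : realType) : 0 < ln 3 :> R.
Proof. by rewrite ln_gt0 // ltr1n. Qed.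

(** A ratio of at least 3/2 persists: it gives [g_n <= 2/3 * g_(n+1)], hence
    [g_(n+2) >= 5/3 * g_(n+1)]. *)
Lemma growth_step (R : realType) n :
  0 < growth R n /\ 3 / 2 * growth R n <= growth R n.+1.
Proof.
elim: n => [|n [IH1 IH2]].
  by rewrite growth0 growth1; have := ln3_gt0 R; lra.
by rewrite growthSS; split; lra.
Qed.

Lemma growth_gt0 (R : realType) n : 0 < growth R n.
Proof. by case: (growth_step R n). Qed.

Lemma growth_ge (R : realType) n : growth R 0 * (1 + n%:R / 2) <= growth R n.
Proof.
elim: n => [|n IH]; first by rewrite mul0r addr0 mulr1.
have [_ h] := growth_step R n; have h0 := growth_gt0 R 0.
have nn : 0 <= growth R 0 * n%:R by rewrite mulr_ge0 ?ler0n // ltW.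
by rewrite -natr1; nra.
Qed.

Lemma growth_cvg (R : realType) : growth R @ \oo --> +oo.
Proof.
apply/cvgryPge => M; near=> n; apply: le_trans (growth_ge R n).
have h0 := growth_gt0 R 0; rewrite -ler_pdivrMl //.
have : 2 * ((growth R 0)^-1 * M) <= n%:R by near: n; exact: nbhs_infty_ger.
lra.
Unshelve. all: by end_near.
Qed.

(* [s n] is u_(n+2) in the notation above. *)
Definition backward_orbit (b : algC) (s : nat -> algC) : Prop :=
  [/\ b ^+ 2 = b + 2^-1, s 0%N = - b, s 1%N = b &
      forall n, s n.+2 ^+ 2 = s n.+1 ^+ 4 / (s n + 2^-1)].

Lemma place3_half (R : realType) (w : algC -> R) :
  extends_place (Some 3%N) w -> w 2^-1 = 1.
Proof.
move=> wP; rewrite (placeV _ wP) (place_nat wP) // logn_coprime //.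
by rewrite expn0 !invr1.
Qed.

(** The quadratic equation makes [b] integral at 3. Then [b] and [b - 1] have size at most 1 while
    their product 1/2 has size 1, so [|b| = 1]. The prime 3 enters through [(1/2 - b)^2 = 3/4]. *)
Lemma place3_base (R : realType) (w : algC -> R) b :
  extends_place (Some 3%N) w -> b ^+ 2 = b + 2^-1 ->
  [/\ w b = 1, w (b + 2^-1) = 1 & w (- b + 2^-1) ^+ 2 = 3^-1].
Proof.
move=> wP eb; have w2 := place3_half wP.
have wb1 : w b <= 1.
  rewrite leNgt; apply/negP => b1.
  have : w (b + 2^-1) <= w b by apply: (place_ultra wP); rewrite // w2 ltW.
  rewrite -eb (placeX _ _ wP) expr2 ger_pMl ?(lt_trans ltr01) //.
  by rewrite leNgt b1.
have wb : w b = 1.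
  apply/eqP; rewrite eq_le wb1 /=.
  have : w (b * (b - 1)) = 1.
    by rewrite mulrBr mulr1 -expr2 eb addrAC subrr add0r.
  rewrite (placeM _ _ wP) => <-; rewrite ler_piMr ?(place_ge0 _ wP) //.
  by apply: (place_ultra wP) => //; rewrite (placeN _ wP) (place1 wP).
split => //; first by rewrite -eb (placeX _ _ wP) wb expr1n.
rewrite -(placeX _ _ wP).
have -> : (- b + 2^-1) ^+ 2 = 3 * 2^-1 ^+ 2.
  have -> : (- b + 2^-1) ^+ 2 = b ^+ 2 - b + 2^-1 ^+ 2 by field.
  by rewrite eb; field.
rewrite (placeM _ _ wP) (placeX _ _ wP) w2 expr1n mulr1 (place_nat wP) //.
Qed.

Lemma ge0_sqr_inj (R : realType) (x y : R) :
  0 <= x -> 0 <= y -> x ^+ 2 = y ^+ 2 -> x = y.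
Proof. by move=> x0 y0 /eqP; rewrite eqrXn2 // => /eqP. Qed.

(** As soon as [|s n| > 1], the summand 1/2 does not affect the size of [s n + 2^-1], and the orbit
    equation becomes the recursion of [growth] on logarithms. Only squares are compared, so the
    choice of square roots is immaterial. *)
Lemma place3_orbit (R : realType) (w : algC -> R) b s n :
  extends_place (Some 3%N) w -> backward_orbit b s ->
  w (s n.+2) = expR (growth R n).
Proof.
move=> wP [eb s0 s1 sS]; have [wb wb1 wb2] := place3_base wP eb.
have w2 := place3_half wP.
suff: w (s n.+2) = expR (growth R n) /\ w (s n.+3) = expR (growth R n.+1) by case.
elim: n => [|n [IH1 IH2]].
  (* Fourth powers are compared, since [place3_base] gives the square of [|1/2 - b|]: here
     [|s 2|^4 = 3]. *)
  have e2 : w (s 2%N) = expR (growth R 0).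
    apply: ge0_sqr_inj; rewrite ?expR_ge0 ?(place_ge0 _ wP) //.
    apply: ge0_sqr_inj; rewrite ?exprn_ge0 ?expR_ge0 ?(place_ge0 _ wP) //.
    rewrite -(placeX _ _ wP) sS s1 s0 (placeM _ _ wP) (placeV _ wP) (placeX _ _ wP).
    rewrite wb expr1n mul1r exprVn wb2 invrK growth0 -exprM -expRM_natl.
    rewrite natrM (_ : 2 * 2 * _ = ln 3); last by field.
    by rewrite lnK // posrE ltr0n.
  split => //; apply: ge0_sqr_inj; rewrite ?expR_ge0 ?(place_ge0 _ wP) //.
  rewrite -(placeX _ _ wP) sS s1 (placeM _ _ wP) (placeV _ wP) (placeX _ _ wP).
  rewrite wb1 invr1 mulr1 e2 growth0 growth1 -!expRM_natl; congr expR.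
  by field.
split => //; apply: ge0_sqr_inj; rewrite ?expR_ge0 ?(place_ge0 _ wP) //.
rewrite -(placeX _ _ wP) sS (placeM _ _ wP) (placeV _ wP) (placeX _ _ wP).
rewrite addrC (place_ultra_eq wP); last first.
  by rewrite w2 IH1 expR_gt1 growth_gt0.
rewrite IH1 IH2 growthSS -!expRM_natl -expRN -expRD; congr expR.
by field.
Qed.

(** Nonvanishing is read off from the 3-adic sizes, which are all positive. *)
Lemma backward_orbit_neq0 (R : realType) b s n :
  backward_orbit b s -> s n != 0 /\ s n + 2^-1 != 0.
Proof.
move=> bs; have [w wP] := exists_extends_place R (isT : prime 3).
have [eb s0 s1 _] := bs; have [wb wb1 wb2] := place3_base wP eb.
case: n => [|[|n]].
- rewrite s0 oppr_eq0 -!(place_eq0 _ wP) wb oner_eq0; split => //.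
  by apply/eqP => e; move/eqP: wb2; rewrite e expr0n eq_sym invr_eq0 pnatr_eq0.
- by rewrite s1 -!(place_eq0 _ wP) wb wb1 oner_eq0.
- have w1 : 1 < w (s n.+2) by rewrite (place3_orbit _ wP bs) expR_gt1 growth_gt0.
  rewrite -!(place_eq0 _ wP) addrC (place_ultra_eq wP) ?(place3_half wP) //.
  by rewrite gt_eqF // (lt_trans ltr01).
Qed.

(** The defining equations have rational coefficients; thus the size estimates also hold for all
    Galois conjugates, as the height requires. *)
Lemma backward_orbit_morph (nu : {rmorphism algC -> algC}) b s :
  backward_orbit b s -> backward_orbit (nu b) (nu \o s).
Proof.
move=> [eb s0 s1 sS]; split => /=.
- by rewrite -rmorphXn eb rmorphD fmorphV rmorph_nat.
- by rewrite s0 rmorphN.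
- by rewrite s1.
- by move=> n; rewrite -rmorphXn sS fmorph_div rmorphXn rmorphD fmorphV rmorph_nat.
Qed.

Fixpoint orbit_pair (b : algC) (n : nat) : algC * algC :=
  if n is n'.+1 then
    let: (x, y) := orbit_pair b n' in (y, y ^+ 2 / sqrtC (x + 2^-1))
  else (- b, b).

Lemma exists_backward_orbit b :
  b ^+ 2 = b + 2^-1 -> exists s, backward_orbit b s.
Proof.
move=> eb; exists (fun n => (orbit_pair b n).1); split => // n /=.
case: (orbit_pair b n) => x y /=.
by rewrite expr_div_n -exprM sqrtCK.
Qed.

(** * Lower bounds for the height *)

Lemma finite_roots (x : algC) : finite_set [set y : algC | root (minCpoly x) y].
Proof.
have [r e] := closed_field_poly_normal (minCpoly x).
apply: sub_finite_set (finite_seq r) => y /=.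
by rewrite e rootZ ?lead_coef_eq0 ?minCpoly_eq0 // root_prod_XsubC.
Qed.

Lemma root_minCpoly_morph (nu : {rmorphism algC -> algC}) x :
  root (minCpoly x) (nu x).
Proof.
have [P [eP _] _] := minCpolyP x.
have := root_minCpoly x; rewrite eP -(fmorph_root nu) -map_poly_comp.
by congr (root _ _); apply: eq_map_poly => q /=; rewrite fmorph_rat.
Qed.

(** The coordinates of a conjugate are roots of three fixed minimal polynomials. Finiteness is
    essential because [fset_set] returns the empty set on infinite sets. *)
Lemma finite_galois_orbit x : finite_set (galois_orbit x).
Proof.
pose X := [set y : algC | exists i, root (minCpoly (x 0 i)) y].
have Xf : finite_set X.
  apply: (@sub_finite_set _ _ (\bigcup_(i in [set: 'I_3]) [set y | root (minCpoly (x 0 i)) y])).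
    by move=> y [i ri]; exists i.
  by apply: bigcup_finite => [|i _]; [exact: finite_finset | exact: finite_roots].
have /finite_seqP[r er] := Xf.
apply: (@sub_finite_set _ _ (range (fun f : {ffun 'I_3 -> seq_sub r} => \row_i val (f i) : 'rV[algC]_3))); last first.
  by apply: finite_image; exact: finite_finset.
move=> _ [nu _ <-] /=.
have xr i : nu (x 0 i) \in r.
  have : X (nu (x 0 i)) by exists i; exact: root_minCpoly_morph.
  by rewrite er.
exists [ffun i => SeqSub (xr i)] => //.
by apply/rowP => i; rewrite !mxE ffunE.
Qed.

(** Covers the default of the choice as well; there the local contribution to the height is
    [ln 0 = 0]. *)
Lemma absv_cases (R : realType) v :
  extends_place v (absv R v) \/ absv R v = fun=> 0.
Proof. by rewrite /absv; case: xgetP => [w ->|]; [left|right]. Qed.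

Definition local_height (R : realType) v (t : 'rV[algC]_3) : R :=
  ln (\big[Num.max/0]_(i < 3) absv R v (t 0 i)).

Lemma local_height_zero (R : realType) v t : absv R v = (fun=> 0) -> local_height R v t = 0.
Proof.
move=> e; rewrite /local_height ln0 //.
by apply: bigmax_le => // i _; rewrite e.
Qed.

Lemma local_height_ge0 (R : realType) v (t : 'rV[algC]_3) i : t 0 i = 1 -> 0 <= local_height R v t.
Proof.
move=> t1; have [vP|/local_height_zero->//] := absv_cases R v.
rewrite ln_ge0 //; apply: le_trans (le_bigmax _ _ i).
by rewrite t1 (place1 vP).
Qed.

(** At almost all primes every coordinate has size at most 1, and the coordinate 1 makes the maximum
    equal to 1. This gives the sum over all places a finite support. *)
Lemma local_height_eq0 (R : realType) (t : 'rV[algC]_3) i : t 0 i = 1 ->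
  exists2 N, (0 < N)%N & forall p, prime p -> ~~ (p %| N)%N ->
    local_height R (Some p) t = 0.
Proof.
move=> t1; pose N j := (s2val (cid2 (place_integral R (t 0 j)))).
exists (\prod_(j < 3) N j)%N.
  by rewrite prodn_gt0 // => j; exact: (s2valP (cid2 (place_integral R (t 0 j)))).
move=> p pp pN; have [vP|/local_height_zero->//] := absv_cases R (Some p).
apply/eqP; rewrite eq_le (local_height_ge0 _ _ t1) andbT /local_height.
rewrite -[leRHS]ln1 ler_ln ?posrE ?ltr01 //; last first.
  apply: (lt_le_trans ltr01); apply: le_trans (le_bigmax _ _ i).
  by rewrite t1 (place1 vP).
apply: bigmax_le => // j _.
have := s2valP' (cid2 (place_integral R (t 0 j))); rewrite -/(N j) => HN; apply: HN pp _ vP.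
by apply: contra pN => pd; rewrite (bigD1 j) //= dvdn_mulr.
Qed.

(** A coordinate equal to 1 survives conjugation and makes all local contributions nonnegative. The
    sum over places has finite support, so it is at least its part at [p], which is an average over
    the conjugates after division. *)
Lemma height_ge (R : realType) (x : 'rV[algC]_3) p c i :
  prime p -> x 0 i = 1 ->
  (forall t, galois_orbit x t -> c <= local_height R (Some p) t) ->
  c <= height R x.
Proof.
move=> pp x1 xc; have Of := finite_galois_orbit x.
have O1 t : galois_orbit x t -> t 0 i = 1.
  by move=> [nu _ <-]; rewrite mxE x1 rmorph1.
have O0 : (0 < #|` fset_set (galois_orbit x)|)%N.
  rewrite cardfs_gt0; apply/eqP => e.
  have : galois_orbit x (map_mx (@idfun algC) x) by exists idfun.
  by rewrite -(fset_setK Of) e /=.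
rewrite /height ler_pdivlMr ?ltr0n //.
pose G v := \sum_(t \in galois_orbit x) local_height R v t.
have G0 v : 0 <= G v by apply: fsumr_ge0 => t /O1 t1; exact: local_height_ge0 t1.
pose supp := placesQ `&` G @^-1` [set~ 0].
have suppf : finite_set supp.
  pose bad t : set (option nat) := [set Some q | q in [set q | prime q /\ local_height R (Some q) t != 0]].
  apply: (@sub_finite_set _ _ ([set None] `|` \bigcup_(t in galois_orbit x) bad t)).
    move=> [q|] [/= pq Gq]; [right|by left].
    apply: contrapT => nbad; apply: Gq; rewrite /G fsbig1 // => t Ot.
    by apply/eqP/negPn/negP => tq; apply: nbad; exists t => //; exists q.
  rewrite finite_setU; split; first exact: finite_set1.
  apply: bigcup_finite => // t /O1 t1; apply: finite_image.
  have [N N0 HN] := local_height_eq0 R t1.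
  apply: (@sub_finite_set _ _ `I_N.+1); last exact: finite_II.
  move=> q [pq] /=; rewrite ltnS; apply: contraNleq => Nq; apply/eqP/HN => //.
  by apply: contraL Nq => /(dvdn_leq N0); rewrite -leqNgt.
rewrite -[X in _ <= X]/(\sum_(v \in placesQ) G v).
(* The place [p] is added to the support so that it can be split off even if its contribution
   vanishes. *)
rewrite -(fsbig_widen (supp `|` [set Some p]) placesQ); first last.
- move=> v [Pv /= /not_orP[+ _]] => /not_andP[//|/=].
  by rewrite /setC /= notK.
- by move=> v [[]//|-> /=].
rewrite (fsbigD1 (Some p)); [|by rewrite finite_setU; split => //; exact: finite_set1|by right].
apply: (@le_trans _ _ (G (Some p))); last first.
  by rewrite lerDl fsumr_ge0.
rewrite /G fsbig_finite //.
have -> : c * (#|` fset_set (galois_orbit x)|)%:R = \sum_(t <- fset_set (galois_orbit x)) c.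
  by rewrite big_const_seq count_predT iter_addr_0 mulr_natr.
rewrite big_seq [leRHS]big_seq; apply: ler_sum => t.
by rewrite in_fset_set // inE; exact: xc.
Qed.

(** * Zariski density of a backward orbit *)

(** The larger root of [t^2 = 2 * t - 1/2], the characteristic equation of the recursion of
    [growth]. *)
Definition growth_rate (R : realType) : R := 1 + (Num.sqrt 2)^-1.

(** In [a^2 = 2 * b^2] with [b] nonzero the exponent of 2 is even on the left and odd on the
    right. *)
Lemma sqrt2_irrational (R : realType) (a b : int) :
  a%:~R + b%:~R * Num.sqrt 2 = 0 :> R -> a = 0 /\ b = 0.
Proof.
move=> e; have e2 : (a%:~R ^+ 2 = 2 * b%:~R ^+ 2 :> R).
  have -> : a%:~R = - (b%:~R * Num.sqrt 2) :> R by apply/eqP; rewrite -addr_eq0 e.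
  by rewrite sqrrN exprMn sqr_sqrtr ?ler0n // mulrC.
have {}e2 : (`|a| ^ 2 = 2 * `|b| ^ 2)%N.
  suff : a ^+ 2 = 2 * b ^+ 2 :> int by move=> /(congr1 absz); rewrite abszM !abszX.
  by apply/eqP; rewrite -(eqr_int R) intrM !rmorphXn /= e2.
have [b0|b0] := eqVneq b 0.
  by split => //; move/eqP: e2; rewrite b0 muln0 expn_eq0 andbT absz_eq0 => /eqP.
have bp : (0 < `|b|)%N by rewrite absz_gt0.
have := congr1 (logn 2) e2.
rewrite lognM ?expn_gt0 ?bp // !lognX (logn_prime 2 (isT : prime 2)) eqxx; lia.
Qed.

Lemma growth_rate_inj (R : realType) (i j i' j' : nat) :
  i%:R + j%:R * growth_rate R = i'%:R + j'%:R * growth_rate R -> i = i' /\ j = j'.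
Proof.
rewrite /growth_rate => e; have s0 : Num.sqrt 2 != 0 :> R by rewrite sqrtr_eq0 -ltNge ltr0n.
(* The coefficients arise on multiplying the difference of the two sides by the square root of 2. *)
have [] := @sqrt2_irrational R (j%:Z - j'%:Z) (i%:Z - i'%:Z + (j%:Z - j'%:Z)).
  rewrite !rmorphD !rmorphN /= -!pmulrn.
  set r := Num.sqrt 2 in s0 e *.
  have -> : i%:R = i'%:R + j'%:R * (1 + r^-1) - j%:R * (1 + r^-1) :> R.
    by rewrite -e addrK.
  by field.
lia.
Qed.

(** The expression is multiplied at each step by [2 - r], the other characteristic root, which lies
    between 0 and 1; its initial value is therefore a bound. *)
Lemma growth_ratio (R : realType) :
  exists D : R, forall n, `|growth R n.+1 - growth_rate R * growth R n| <= D.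
Proof.
exists `|growth R 1 - growth_rate R * growth R 0|.
set r := growth_rate R.
have s2 : Num.sqrt 2 ^+ 2 = 2 :> R by rewrite sqr_sqrtr ?ler0n.
have s0 : 0 < Num.sqrt 2 :> R by rewrite sqrtr_gt0 ltr0n.
have s1 : 1 < Num.sqrt 2 :> R by rewrite -[ltLHS]sqrtr1 ltr_sqrt ?ltr1n.
have r12 : 1 < r < 2.
  have i0 : 0 < (Num.sqrt 2)^-1 :> R by rewrite invr_gt0.
  have i1 : (Num.sqrt 2)^-1 < 1 :> R by rewrite invf_lt1.
  by rewrite /r /growth_rate; move: i0 i1; set v := _^-1 => i0 i1; apply/andP; split; lra.
have rr : r * (2 - r) = 1 / 2.
  rewrite /r /growth_rate; have -> : (1 : R) / 2 = 1 - (Num.sqrt 2 ^+ 2)^-1 by rewrite s2; field.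
  by field; rewrite gt_eqF.
elim=> [//|n IH]; apply: le_trans IH.
have -> : growth R n.+2 - r * growth R n.+1 = (2 - r) * (growth R n.+1 - r * growth R n).
  by rewrite growthSS mulrBr mulrA [(2 - r) * r]mulrC rr; field.
by rewrite normrM ler_piMl // ger0_norm; lra.
Qed.

Lemma exists_seq_max (R : realDomainType) (T : eqType) (f : T -> R) (s : seq T) :
  s != [::] -> exists2 x, x \in s & forall y, y \in s -> f y <= f x.
Proof.
elim: s => // a [|b s] IH _; first by exists a; rewrite ?mem_seq1 // => y; rewrite mem_seq1 => /eqP->.
have [x xs xm] := IH isT.
have [ax|xa] := leP (f a) (f x).
  by exists x; [rewrite inE xs orbT | move=> y; rewrite inE => /predU1P[->|/xm]].
exists a; first by rewrite inE eqxx.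
by move=> y; rewrite inE => /predU1P[->//|/xm yx]; exact: le_trans yx (ltW xa).
Qed.

Lemma eventually_all (T : eqType) (s : seq T) (P : T -> nat -> Prop) :
  (forall x, x \in s -> exists N, forall n, (N <= n)%N -> P x n) ->
  exists N, forall n x, (N <= n)%N -> x \in s -> P x n.
Proof.
elim: s => [|a s IH] H; first by exists 0%N.
have [N HN] := IH (fun x xs => H x (mem_behead (s := a :: s) xs)).
have [M HM] := H a (mem_head _ _).
exists (maxn M N) => n x; rewrite geq_max => /andP[Mn Nn].
by rewrite inE => /predU1P[->|xs]; [exact: HM|exact: HN].
Qed.

(** Replacing [g_(n+1)] by [r * g_n] costs a bounded error, so the two sides differ by a positive
    multiple of [g_n] up to a bounded amount, and [g_n] tends to infinity. *)
Lemma dominant_term (R : realType) (i j i' j' : nat) (K : R) :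
  i%:R + j%:R * growth_rate R < i'%:R + j'%:R * growth_rate R ->
  exists N, forall n, (N <= n)%N ->
    K + (i%:R * growth R n + j%:R * growth R n.+1) <=
    i'%:R * growth R n + j'%:R * growth R n.+1.
Proof.
move=> lt; have [D HD] := growth_ratio R.
set r := growth_rate R in lt HD *; pose e := (i'%:R + j'%:R * r) - (i%:R + j%:R * r).
have e0 : 0 < e by rewrite subr_gt0.
pose B := `|j'%:R - j%:R| * D.
have /cvgryPge/(_ ((K + B) / e)) [N _ HN] := @growth_cvg R.
exists N => n Nn; have := HN n Nn; rewrite ler_pdivrMr // => le.
have : `|(j'%:R - j%:R) * (growth R n.+1 - r * growth R n)| <= B.
  by rewrite normrM ler_wpM2l.
rewrite ler_norml => /andP[lo _].
set g := growth R n in le lo *; set h := growth R n.+1 in lo *.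
have -> : K + (i%:R * g + j%:R * h) = i'%:R * g + j'%:R * h
    + (K - g * e - (j'%:R - j%:R) * (h - r * g)) by rewrite /e; ring.
lra.
Qed.

Lemma big_ord3 (T : Type) (idx : T) (op : Monoid.law idx) (F : 'I_3 -> T) :
  \big[op/idx]_(i < 3) F i = op (op (F (inord 0)) (F (inord 1))) (F (inord 2)).
Proof.
rewrite !big_ord_recr big_ord0 /= Monoid.mul1m.
by congr (op (op (F _) (F _)) (F _)); apply/val_inj; rewrite /= inordK.
Qed.

(** The monomials of [q] grow along the orbit at pairwise different rates [mu]. Far along the orbit
    the fastest one is strictly larger than all others, and the ultrametric inequality excludes
    cancellation. *)
Lemma homog_nonvanishing (R : realType) b s (q : {mpoly algC[3]}) k :
  backward_orbit b s -> q \is k.-homog -> q != 0 ->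
  exists n, q.@[coords (s n.+2) (s n.+3) 1 0] != 0.
Proof.
move=> bs qk q0; have [w wP] := exists_extends_place R (isT : prime 3).
pose i0 : 'I_3 := inord 0; pose i1 : 'I_3 := inord 1; pose i2 : 'I_3 := inord 2.
apply: contrapT => /forallNP qz.
pose mu (m : 'X_{1..3}) : R := (m i0)%:R + (m i1)%:R * growth_rate R.
(* Irrationality of the growth rate recovers the first two exponents, and the degree recovers the
   third. *)
have mu_inj m m' : m \in msupp q -> m' \in msupp q -> mu m = mu m' -> m = m'.
  move=> /(dhomogP _ _ _ qk) em /(dhomogP _ _ _ qk) em' /growth_rate_inj[e0 e1].
  move: em; rewrite -em' /= !mdegE !big_ord3 -/i0 -/i1 -/i2 e0 e1 => /addnI e2.
  apply/mnmP => -[[|[|[|//]]] lt].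
  - by move: e0; congr (m _ = m' _); apply/val_inj; rewrite /= inordK.
  - by move: e1; congr (m _ = m' _); apply/val_inj; rewrite /= inordK.
  - by move: e2; congr (m _ = m' _); apply/val_inj; rewrite /= inordK.
have [m0 m0q m0max] : exists2 x, x \in msupp q & forall y, y \in msupp q -> mu y <= mu x.
  by apply: exists_seq_max; rewrite msupp_eq0.
pose X n (m : 'X_{1..3}) : algC := q@_m * \prod_i (coords (s n.+2) (s n.+3) 1 0 i) ^+ m i.
pose E n (m : 'X_{1..3}) : R := (m i0)%:R * growth R n + (m i1)%:R * growth R n.+1.
have wX n m : w (X n m) = w q@_m * expR (E n m).
  rewrite (placeM _ _ wP) big_ord3 !(placeM _ _ wP) !(placeX _ _ wP) !mxE !inordK //=.
  rewrite !(place3_orbit _ wP bs) (place1 wP) expr1n mulr1.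
  by rewrite -!expRM_natl -expRD.
have wq m : m \in msupp q -> 0 < w q@_m.
  by move=> mq; rewrite (place_gt0 wP) // -mcoeff_msupp.
(* The factor 1/2 only encodes strictness: an ultrametric sum is bounded by its largest term,
   however many terms there are. *)
have [N HN] : exists N, forall n m, (N <= n)%N -> m \in rem m0 (msupp q) ->
    w (X n m) <= w (X n m0) / 2.
  apply: eventually_all => m mq.
  have [mm0 mS] : m != m0 /\ m \in msupp q.
    by move: mq; rewrite (rem_filter _ (msupp_uniq q)) mem_filter => /andP[].
  have [|N HN] := @dominant_term R (m i0) (m i1) (m0 i0) (m0 i1)
     (ln (w q@_m) - ln (w q@_m0) + ln 2).
    by rewrite lt_neqAle m0max // andbT; apply: contra mm0 => /eqP/mu_inj->.
  exists N => n Nn; rewrite ler_pdivlMr // !wX.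
  have ew m' z : m' \in msupp q -> w q@_m' * expR z = expR (ln (w q@_m') + z).
    by move=> /wq w0; rewrite expRD lnK.
  have e2 z : expR z * 2 = expR (ln 2 + z) :> R.
    by rewrite expRD lnK ?posrE // mulrC.
  rewrite ew // ew // e2 ler_expR.
  have := HN n Nn; rewrite -/(E n m) -/(E n m0); lra.
have := qz N => /negP; rewrite negbK => /eqP qN.
have eX : X N m0 = - \sum_(m <- rem m0 (msupp q)) X N m.
  apply/eqP; rewrite -addr_eq0; move/eqP: qN; rewrite mevalE.
  by rewrite (perm_big _ (perm_to_rem m0q)) big_cons.
have X0 : 0 < w (X N m0) by rewrite wX mulr_gt0 ?wq ?expR_gt0.
have : w (X N m0) <= w (X N m0) / 2; last by lra.
rewrite {1}eX (placeN _ wP) big_seq.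
elim/big_ind: _ => [|x y|m mq].
- by rewrite (place0 wP) divr_ge0 // ltW.
- exact: place_ultra wP.
- exact: HN.
Qed.

(** * Values of multivariate polynomials *)

(** Uniqueness of the base [N] expansion, peeling off the lowest digit; it keeps distinct monomials
    apart under Kronecker substitution. *)
Lemma digits_inj N n (a b : 'I_n -> nat) :
  (forall i, a i < N)%N -> (forall i, b i < N)%N ->
  (\sum_(i < n) a i * N ^ i = \sum_(i < n) b i * N ^ i)%N -> a =1 b.
Proof.
elim: n a b => [|n IH] a b aN bN; first by move=> _ [].
rewrite !big_ord_recl !expn0 !muln1.
have E (f : 'I_n.+1 -> nat) :
    (\sum_(i < n) f (lift ord0 i) * N ^ bump 0 i =
     (\sum_(i < n) f (lift ord0 i) * N ^ i) * N)%N.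
  by rewrite big_distrl /=; apply: eq_bigr => i _; rewrite -mulnA -expnSr.
rewrite !E ![(_ ord0 + _)%N]addnC => e.
have N0 : (0 < N)%N by exact: leq_ltn_trans (aN ord0).
have e0 : a ord0 = b ord0.
  by move: (congr1 (modn^~ N) e); rewrite !modnMDl !modn_small.
have e1 := congr1 (divn^~ N) e; rewrite /= !divnMDl // !divn_small // !addn0 in e1.
have eL := IH _ _ (fun i => aN (lift ord0 i)) (fun i => bN (lift ord0 i)) e1.
by move=> i; case: (unliftP ord0 i) => [j ->|->].
Qed.

Definition curve_poly (n : nat) (K : fieldType) (h : 'I_n -> {poly K})
  (q : {mpoly K[n]}) : {poly K} := mmap polyC h q.

Lemma curve_polyE n (K : fieldType) h (q : {mpoly K[n]}) t :
  (curve_poly h q).[t] = q.@[fun i => (h i).[t]].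
Proof.
rewrite /curve_poly /mmap horner_sum mevalE; apply: eq_bigr => m _.
rewrite hornerM hornerC horner_prod; congr (_ * _).
by apply: eq_bigr => i _; rewrite horner_exp.
Qed.

(* Kronecker substitution X_i = T^(N^i). *)
Lemma meval_eq0 n (K : closedFieldType) (q : {mpoly K[n]}) :
  (forall v, q.@[v] = 0) -> q = 0.
Proof.
move=> q0; pose N := msize q.
pose h (i : 'I_n) : {poly K} := 'X^(N ^ i).
have P0 : curve_poly h q = 0.
  apply/eqP/negPn/negP => /closed_nonrootP[t]; rewrite /root curve_polyE q0 eqxx //.
apply/mpolyP => m; rewrite mcoeff0.
have [mq|/memN_msupp_eq0//] := boolP (m \in msupp q).
have lt m' i : m' \in msupp q -> (m' i < N)%N.
  move=> /msize_mdeg_lt; apply: leq_ltn_trans.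
  by rewrite mdegE (bigD1 i) //= leq_addr.
have := congr1 (fun P : {poly K} => P`_(\sum_(i < n) m i * N ^ i)) P0.
rewrite coef0 /curve_poly /mmap coef_sum.
have E m' : ((q@_m')%:P * mmap1 h m')`_(\sum_(i < n) m i * N ^ i) =
    q@_m' * ((\sum_(i < n) m i * N ^ i)%N == (\sum_(i < n) m' i * N ^ i)%N)%:R.
  have -> : mmap1 h m' = 'X^(\sum_(i < n) m' i * N ^ i).
    rewrite /mmap1 (big_morph _ (exprD 'X) (expr0 'X)).
    by apply: eq_bigr => i _; rewrite /h -exprM mulnC.
  by rewrite coefCM coefXn.
rewrite (perm_big _ (perm_to_rem mq)) big_cons E eqxx mulr1 big1_seq /= ?addr0 //.
move=> m'; rewrite rem_filter ?msupp_uniq // mem_filter => /andP[/= m'm m'q].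
rewrite E; case: eqP => [/digits_inj e|_]; last by rewrite mulr0.
by case/eqP: m'm; apply/mnmP => i; rewrite -e // => j; exact: lt.
Qed.

Lemma meval_neq0 n (K : closedFieldType) (q : {mpoly K[n]}) :
  q != 0 -> exists v, q.@[v] != 0.
Proof.
move=> /eqP q0; apply: contrapT => /forallNP nv; apply/q0/meval_eq0 => v.
by apply/eqP/negPn/negP => /(nv v).
Qed.

Lemma meval_dhomog n (K : fieldType) (q : {mpoly K[n]}) k (c : K) v :
  q \is k.-homog -> q.@[fun i => c * v i] = c ^+ k * q.@[v].
Proof.
move=> /dhomogP qk; rewrite !mevalE mulr_sumr big_seq [RHS]big_seq.
apply: eq_bigr => m /qk <-; rewrite mulrCA; congr (_ * _).
rewrite /= mdegE (big_morph _ (exprD c) (expr0 c)) -big_split /=.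
by apply: eq_bigr => i _; rewrite exprMn.
Qed.

Lemma meval_pihomog n (K : fieldType) (q : {mpoly K[n]}) c v :
  q.@[fun i => c * v i] =
  (\sum_(k < msize q) (pihomog mdeg k q).@[v] *: 'X^k).[c].
Proof.
rewrite {1}(@pihomog_partitionE _ _ mdeg (msize q) q (leqnn _)) raddf_sum horner_sum.
apply: eq_bigr => k _ /=; rewrite (meval_dhomog _ _ (pihomogP mdeg k q)).
by rewrite hornerZ hornerXn mulrC.
Qed.

(** Along the line through [v] the form parts of [q] are the coefficients of a polynomial in the
    scaling factor. This passes from arbitrary polynomials to the homogeneous ones that define
    closed sets of the plane. *)
Lemma pihomog_scale_neq0 n (K : closedFieldType) (q : {mpoly K[n]}) k v :
  (pihomog mdeg k q).@[v] != 0 ->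
  exists2 c, c != 0 & q.@[fun i => c * v i] != 0.
Proof.
move=> qk; set P := \sum_(k < msize q) (pihomog mdeg k q).@[v] *: 'X^k.
have [kq|kq] := ltnP k (msize q); last first.
  have [m mq em] : exists2 m, m \in msupp q & mdeg m = k.
    apply: contrapT => nex; move/eqP: qk; apply.
    rewrite pihomogE big_seq_cond big1 ?meval0 // => m /andP[mq /eqP mk].
    by case: nex; exists m.
  by have := msize_mdeg_lt mq; rewrite em ltnNge kq.
(* The extra factor ['X] forces the nonroot to be nonzero. *)
have P0 : P * 'X != 0.
  rewrite mulf_eq0 polyX_eq0 orbF; apply: contraNneq qk => P0.
  have := congr1 (fun P : {poly K} => P`_k) P0.
  rewrite coef0 coef_sum (bigD1 (Ordinal kq)) //= coefZ coefXn eqxx mulr1.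
  rewrite big1 ?addr0 => [->//|i]; rewrite -val_eqE /= => ik.
  by rewrite coefZ coefXn eq_sym (negbTE ik) mulr0.
have /closed_nonrootP[c] := P0.
rewrite /root hornerM hornerX mulf_eq0 => /norP[Pc c0].
by exists c => //; rewrite meval_pihomog.
Qed.

(** Over an algebraically closed field, a polynomial without zeros on a line restricts to a constant
    there. *)
Lemma meval_line_const n (K : closedFieldType) (q : {mpoly K[n]}) (u v : 'I_n -> K) :
  (forall t, q.@[fun i => u i + t * (v i - u i)] != 0) -> q.@[u] = q.@[v].
Proof.
move=> nz; pose P := curve_poly (fun i => (u i)%:P + 'X * (v i - u i)%:P) q.
have PE t : P.[t] = q.@[fun i => u i + t * (v i - u i)].
  by rewrite curve_polyE; apply: meval_eq => i; rewrite !hornerE.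
have /size_poly1P[c _ Pc] : size P == 1%N.
  apply: contraT => /closed_rootP[t]; rewrite /root PE => /eqP e.
  by have := nz t; rewrite e eqxx.
have := PE 0; have := PE 1; rewrite Pc !hornerC => -> e.
transitivity q.@[fun i => u i + 0 * (v i - u i)].
  by apply: meval_eq => i; rewrite mul0r addr0.
by rewrite -e; apply: meval_eq => i; rewrite mul1r addrC subrK.
Qed.

(** * Degrees of the iterates *)

Lemma coordsE (x : 'rV[algC]_3) :
  x = coords (x 0 (inord 0)) (x 0 (inord 1)) (x 0 (inord 2)).
Proof.
apply/rowP => -[[|[|[|//]]] lt]; rewrite mxE /=; congr (x 0 _);
  by apply/val_inj; rewrite /= inordK.
Qed.

Lemma coords0 x y z : coords x y z 0 (inord 0) = x.
Proof. by rewrite mxE inordK. Qed.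

Lemma coords1 x y z : coords x y z 0 (inord 1) = y.
Proof. by rewrite mxE inordK. Qed.

Lemma coords2 x y z : coords x y z 0 (inord 2) = z.
Proof. by rewrite mxE inordK. Qed.

Lemma coords_inj x y z x' y' z' :
  coords x y z = coords x' y' z' -> [/\ x = x', y = y' & z = z'].
Proof.
by move=> e; split; [rewrite -(coords0 x y z)|rewrite -(coords1 x y z)|rewrite -(coords2 x y z)];
   rewrite e ?coords0 ?coords1 ?coords2.
Qed.

Lemma scale_coords c x y z : c *: coords x y z = coords (c * x) (c * y) (c * z).
Proof.
by apply/rowP => -[[|[|[|//]]] lt]; rewrite !mxE.
Qed.

Lemma coords_eq0 x y z : (coords x y z == 0) = [&& x == 0, y == 0 & z == 0].
Proof.
apply/eqP/and3P => [e|[/eqP-> /eqP-> /eqP->]].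
  by rewrite -[in x == 0](coords0 x y z) -[in y == 0](coords1 x y z)
    -[in z == 0](coords2 x y z) e !mxE.
by apply/rowP => -[[|[|[|//]]] lt]; rewrite !mxE.
Qed.

(** The lift of the map to homogeneous coordinates, with [c] in place of [p^-(d-3)]; iterating it
    avoids composing polynomials. *)
Definition cone_map (c : algC) (d : nat) (v : 'rV[algC]_3) : 'rV[algC]_3 :=
  let x := v 0 (inord 0) in let y := v 0 (inord 1) in let z := v 0 (inord 2) in
  coords (x ^+ d - c * (y ^+ 2 * z ^+ (d - 2))) (x * y ^+ 2 * z ^+ (d - 3))
         (y ^+ 2 * z ^+ (d - 2)).

Lemma eval_ratmap d p v :
  eval_triple (ratmap_f d p) v = cone_map (p%:R ^- (d - 3)) d v.
Proof.
apply/rowP => -[[|[|[|//]]] lt]; rewrite !mxE (tnth_nth 0) /=;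
  by rewrite ?mevalB ?mevalZ ?mevalM ?mevalXn ?(rmorphXn, mevalXU) //= ?mevalXU.
Qed.

Lemma eval_comp F G v : eval_triple (comp_triple F G) v = eval_triple F (eval_triple G v).
Proof.
apply/rowP => i; rewrite !mxE tnth_mktuple comp_mpoly_meval.
by apply: meval_eq => j; rewrite mxE.
Qed.

Lemma eval_iter F n v : eval_triple (iter_triple F n) v = iter n (eval_triple F) v.
Proof.
elim: n => [|n IH] /=; last by rewrite eval_comp IH.
by apply/rowP => i; rewrite mxE tnth_mktuple mevalXU.
Qed.

Lemma eval_iter_ratmap d p n v :
  eval_triple (iter_triple (ratmap_f d p) n) v = iter n (cone_map (p%:R ^- (d - 3)) d) v.
Proof.
by rewrite eval_iter; apply: eq_iter => u; exact: eval_ratmap.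
Qed.

Lemma comp_mpoly_dhomog n m (K : comNzRingType) (q : {mpoly K[n]}) k e (G : n.-tuple {mpoly K[m]}) :
  q \is k.-homog -> (forall i, tnth G i \is e.-homog) -> (q \mPo G) \is (e * k).-homog.
Proof.
move=> /dhomogP qk Gh; rewrite comp_mpolyEX big_seq; apply: rpred_sum => mm /qk <-.
apply: rpredZ; rewrite comp_mpolyX /= mdegE big_distrr /=.
apply: (big_rec2 (fun (a : {mpoly K[m]}) b => a \is b.-homog)); first exact: dhomog1.
by move=> i a b _ ab; rewrite addnC mulrC; apply: dhomogM => //; exact: dhomogMn.
Qed.

Lemma ratmap_dhomog d p i : (3 <= d)%N -> tnth (ratmap_f d p) i \is d.-homog.
Proof.
move=> hd; have X1 (j : 'I_3) : ('X_j : {mpoly algC[3]}) \is 1.-homog.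
  by rewrite dhomogX /= mdeg1.
have Xn (j : 'I_3) k : ('X_j ^+ k : {mpoly algC[3]}) \is k.-homog.
  by have := dhomogMn k (X1 j); rewrite mul1n.
have yz : ('X_(inord 1) ^+ 2 * 'X_(inord 2) ^+ (d - 2) : {mpoly algC[3]}) \is d.-homog.
  by rewrite -[d in d.-homog](subnKC (ltnW hd)); exact: dhomogM.
case: i => -[|[|[|//]]] lt; rewrite (tnth_nth 0) //=.
  by rewrite rpredB // rpredZ.
have -> : d = (1 + 2 + (d - 3))%N by rewrite subnKC.
by rewrite addKn; apply: dhomogM => //; exact: dhomogM.
Qed.

Lemma iter_dhomog d p n i :
  (3 <= d)%N -> tnth (iter_triple (ratmap_f d p) n) i \is (d ^ n).-homog.
Proof.
move=> hd; elim: n i => [|n IH] i; first by rewrite tnth_mktuple dhomogX /= mdeg1.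
rewrite tnth_mktuple expnSr; apply: comp_mpoly_dhomog => //; exact: ratmap_dhomog.
Qed.

(** The cone over the two points (0:1:0) and (0:0:1). *)
Definition base_locus (v : 'rV[algC]_3) : Prop :=
  v 0 (inord 0) = 0 /\ (v 0 (inord 1) = 0 \/ v 0 (inord 2) = 0).

(** Backward invariance: a common zero of the components of an iterate is sent to the origin, which
    lies in the locus, and so lies in the locus itself. *)
Lemma base_locus_cone_map c d v :
  (3 <= d)%N -> c != 0 -> base_locus (cone_map c d v) -> base_locus v.
Proof.
move=> hd c0; rewrite /base_locus /cone_map coords0 coords1 coords2.
set x := v 0 (inord 0); set y := v 0 (inord 1); set z := v 0 (inord 2).
have yz0 : y ^+ 2 * z ^+ (d - 2) = 0 -> y = 0 \/ z = 0.
  by move/eqP; rewrite mulf_eq0 !expf_eq0 => /orP[|] /andP[_ /eqP]; [left|right].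
have xd0 : x ^+ d = 0 -> x = 0 by move/eqP; rewrite expf_eq0 => /andP[_ /eqP].
move=> [e0 [/eqP|e]].
  rewrite -mulrA mulf_eq0 => /orP[/eqP x0|]; last first.
    rewrite mulf_eq0 => /orP[y0|z0]; last first.
    - have {}z0 : z = 0 by move: z0; rewrite expf_eq0 => /andP[_ /eqP].
      split; last by right.
      apply: xd0; move: e0; rewrite z0 expr0n.
      by rewrite (_ : (d - 2 == 0)%N = false) ?mulr0 ?subr0 //; lia.
    - have {}y0 : y = 0 by move: y0; rewrite expf_eq0 => /eqP.
      by split; [apply: xd0; move: e0; rewrite y0 expr0n mul0r mulr0 subr0|left].
  - split => //; apply: yz0; move: e0; rewrite x0 expr0n gtn_eqF ?(ltn_trans _ hd) //.
    by rewrite sub0r => /eqP; rewrite oppr_eq0 mulf_eq0 (negbTE c0) => /eqP.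
move: e0; rewrite e mulr0 subr0 => /xd0 x0; split => //; exact: yz0.
Qed.

Lemma base_locus_iter c d n v :
  (3 <= d)%N -> c != 0 -> iter n (cone_map c d) v = 0 -> base_locus v.
Proof.
move=> hd c0 e; suff : base_locus (iter n (cone_map c d) v).
  by elim: n {e} => //= n IH /(base_locus_cone_map hd c0).
by rewrite e; split; [|left]; rewrite mxE.
Qed.

(* Two points off the base locus are joined by at most two lines missing it. *)
Lemma const_off_base_locus (D : {mpoly algC[3]}) :
  (forall v : 'rV[algC]_3, D.@[v 0] = 0 -> base_locus v) -> exists c : algC, D = c%:MP.
Proof.
move=> Dbase; pose one : 'rV[algC]_3 := coords 1 1 1.
have line (u v : 'rV[algC]_3) : (forall t, ~ base_locus (u + t *: (v - u))) -> D.@[u 0] = D.@[v 0].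
  move=> nb; apply: meval_line_const => t; apply/eqP => e; apply: (nb t).
  by apply: Dbase; rewrite -[RHS]e; apply: meval_eq => i; rewrite !mxE.
have Dc (v : 'rV[algC]_3) : v 0 (inord 0) != 0 -> D.@[v 0] = D.@[one 0].
  move=> v0; transitivity D.@[coords (v 0 (inord 0)) 1 1 0]; apply: line => t [].
    rewrite !mxE inordK //= subrr mulr0 addr0 => v00.
    by rewrite v00 eqxx in v0.
  by move=> _; rewrite !mxE !inordK //= !subrr !mulr0 !addr0 => -[]/eqP; rewrite oner_eq0.
exists D.@[one 0]; apply/eqP; rewrite -subr_eq0.
(* Multiplying the difference by the first variable turns constancy off the plane [x = 0] into
   vanishing everywhere. *)
have X0 : ('X_(inord 0) : {mpoly algC[3]}) != 0.
  apply/eqP => /(congr1 (fun q : {mpoly algC[3]} => q.@[one 0])).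
  by rewrite mevalXU meval0 coords0 => /eqP; rewrite oner_eq0.
rewrite -(mulrI_eq0 _ (mulfI X0)); apply/eqP/meval_eq0 => v.
rewrite mevalM mevalXU mevalB mevalC; have [->|v0] := eqVneq (v (inord 0)) 0; first by rewrite mul0r.
have -> : D.@[v] = D.@[(\row_i v i) 0] by apply: meval_eq => i; rewrite mxE.
by rewrite Dc ?mxE // subrr mulr0.
Qed.

Lemma p_inv_neq0 p k : prime p -> (p%:R ^- k : algC) != 0.
Proof. by move=> pp; rewrite invr_eq0 expf_neq0 // pnatr_eq0 -lt0n prime_gt0. Qed.

(** A common factor of the components can vanish only on the base locus, hence is constant; this
    keeps the degree at [d ^ n]. *)
Lemma iter_reduced d p n : (3 <= d)%N -> prime p ->
  is_reduced_form (iter_triple (ratmap_f d p) n) (d ^ n) (iter_triple (ratmap_f d p) n).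
Proof.
move=> hd pp; have c0 := p_inv_neq0 (d - 3) pp; split.
- by move=> i; exact: iter_dhomog.
- move=> D DQ; apply: const_off_base_locus => v Dv.
  apply: (base_locus_iter (n := n) hd c0); rewrite -eval_iter_ratmap.
  by apply/rowP => i; rewrite !mxE; have [Q ->] := DQ i; rewrite mevalM Dv mul0r.
- apply: contrapT => /forallNP F0.
  have [] : base_locus (coords 1 1 1).
    apply: (base_locus_iter (n := n) hd c0); rewrite -eval_iter_ratmap.
    apply/rowP => i; rewrite !mxE; have /negP := F0 i; rewrite negbK => /eqP->.
    by rewrite meval0.
  by rewrite coords0 => /eqP; rewrite oner_eq0.
- by move=> i j; rewrite mulrC.
Qed.

Lemma ratmap_reduced d p : (3 <= d)%N -> prime p ->
  is_reduced_form (ratmap_f d p) d (ratmap_f d p).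
Proof.
move=> hd pp; have := iter_reduced 1 hd pp; rewrite expn1.
suff -> : iter_triple (ratmap_f d p) 1 = ratmap_f d p by [].
by apply: eq_from_tnth => i; rewrite tnth_mktuple comp_mpoly_id.
Qed.

Lemma powR_expn_cvg (R : realType) (m : nat) :
  (fun n => (m ^ n)%:R `^ n%:R^-1 : R) @ \oo --> (m%:R : R).
Proof.
apply: cvg_near_cst; near=> n; rewrite natrX -powR_mulrn ?ler0n // -powRrM.
by rewrite mulfV ?powRr1 ?ler0n // pnatr_eq0 -lt0n; near: n; exact: nbhs_infty_gt.
Unshelve. all: by end_near.
Qed.

Lemma dynamical_degree1 (R : realType) d p : (3 <= d)%N -> prime p ->
  is_dynamical_degree 1 (ratmap_f d p) (d%:R : R).
Proof.
move=> hd pp; exists (fun n => (d ^ n)%N); split; last exact: powR_expn_cvg.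
by move=> n; exists (d ^ n)%N, (iter_triple (ratmap_f d p) n); split => //; exact: iter_reduced.
Qed.

(** * Fibres of the iterates *)

Lemma pt_scale (c : algC) (x : 'rV[algC]_3) : c != 0 -> pt (c *: x) = pt x.
Proof. by move=> c0; apply/eq_genmx/eqmx_scale. Qed.

Lemma pt_inj (x y : 'rV[algC]_3) : x != 0 -> pt x = pt y ->
  exists2 c, c != 0 & x = c *: y.
Proof.
move=> x0 e; have /sub_rVP[c xc] : (x <= y)%MS by rewrite -(genmxE x) -/(pt x) e genmxE.
by exists c => //; apply: contra_neq x0 => c0; rewrite xc c0 scale0r.
Qed.

Lemma cone_map_scale c d k v : (3 <= d)%N -> cone_map c d (k *: v) = k ^+ d *: cone_map c d v.
Proof.
move=> hd; rewrite /cone_map scale_coords !mxE.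
have e2 : k ^+ d = k ^+ 2 * k ^+ (d - 2) by rewrite -exprD subnKC // ltnW.
have e3 : k ^+ d = k * k ^+ 2 * k ^+ (d - 3) by rewrite -exprS -exprD subnKC.
rewrite !exprMn mulrBr; congr coords; first by congr (_ - _); rewrite e2; ring.
  by rewrite e3; ring.
by rewrite e2; ring.
Qed.

Lemma iter_cone_map_scale c d n k v : (3 <= d)%N ->
  iter n (cone_map c d) (k *: v) = k ^+ (d ^ n) *: iter n (cone_map c d) v.
Proof.
move=> hd; elim: n => [|n IH] /=; first by rewrite expr1.
by rewrite IH cone_map_scale // -exprM -expnSr.
Qed.

Lemma cone_map0 c d : (3 <= d)%N -> cone_map c d 0 = 0.
Proof.
move=> hd; rewrite -(scale0r (0 : 'rV[algC]_3)) cone_map_scale //.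
by rewrite expr0n gtn_eqF ?scale0r // (ltn_trans _ hd).
Qed.

(** The homogeneous form of the denominator [u + c]: the preimages of (u:v:w) are the points (v:r:w)
    with [r^2 = v^d / branch_denom]. *)
Definition branch_denom (c : algC) (d : nat) (u v w : algC) : algC :=
  w ^+ (d - 3) * (u + c * w).

Lemma cone_map_preimage c d u v w r : (3 <= d)%N -> w != 0 -> u + c * w != 0 ->
  r ^+ 2 = v ^+ d / branch_denom c d u v w ->
  cone_map c d (coords v r w) = (r ^+ 2 * w ^+ (d - 3)) *: coords u v w.
Proof.
move=> hd w0 uw0 er; rewrite /cone_map coords0 coords1 coords2 scale_coords.
have e2 : w ^+ (d - 2) = w ^+ (d - 3) * w by rewrite -exprSr; congr (_ ^+ _); lia.
have evd : v ^+ d = r ^+ 2 * w ^+ (d - 3) * (u + c * w).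
  by rewrite er /branch_denom; field; rewrite uw0 expf_neq0.
by rewrite evd e2; congr coords; ring.
Qed.

(** The last two coordinates of the image fix the ratio of the first and third coordinates of [x];
    the remaining equation fixes the square of the middle one, leaving two signs. *)
Lemma cone_map_fibre c d u v w r x k : (3 <= d)%N -> w != 0 -> u + c * w != 0 ->
  r ^+ 2 = v ^+ d / branch_denom c d u v w ->
  k != 0 -> cone_map c d x = k *: coords u v w ->
  exists2 m, m != 0 & x = m *: coords v r w \/ x = m *: coords v (- r) w.
Proof.
move=> hd w0 uw0 er k0; rewrite /cone_map scale_coords.
set a := x 0 _; set b := x 0 (inord 1); set z := x 0 (inord 2).
move=> /coords_inj[e0 e1 e2].
have e23 : z ^+ (d - 2) = z ^+ (d - 3) * z by rewrite -exprSr; congr (_ ^+ _); lia.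
have kw : k * w != 0 by rewrite mulf_neq0.
have z0 : z != 0.
  by apply: contra_neq kw => z0; rewrite -e2 e23 z0 !mulr0.
have [m m0 ez] : exists2 m, m != 0 & z = m * w.
  by exists (z / w); rewrite ?divfK // mulf_neq0 ?invr_eq0.
have ea : a = m * v.
  apply: (mulfI kw); transitivity (z * (k * v)); last by rewrite ez; ring.
  by rewrite -e1 -e2 e23; ring.
have ead : a ^+ d = k * (u + c * w).
  by move: e0; rewrite e2 => /eqP; rewrite subr_eq => /eqP->; ring.
have eb : b ^+ 2 = (m * r) ^+ 2.
  have ed : m ^+ d = m ^+ 2 * m ^+ (d - 3) * m.
    by rewrite -exprD -exprSr; congr (_ ^+ _); lia.
  have n1 : z ^+ (d - 2) * (u + c * w) != 0 by rewrite mulf_neq0 ?expf_neq0.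
  apply: (mulIf n1); rewrite mulrA e2 exprMn er /branch_denom e23 ez !exprMn.
  transitivity (w * (m * v) ^+ d); first by rewrite -ea ead; ring.
  by rewrite exprMn ed; field; rewrite uw0 expf_neq0.
exists m => //; rewrite [x]coordsE -/a -/b -/z ea ez !scale_coords mulrN.
move/eqP: eb; rewrite -subr_eq0 subr_sqr mulf_eq0 subr_eq0 addr_eq0.
by case/orP=> /eqP->; [left|right].
Qed.

Definition fibre (G : triple) (y : 'rV[algC]_3) : set 'M[algC]_3 :=
  [set pt x | x in [set x | [/\ P2 x, eval_triple G x != 0 &
                                pt (eval_triple G x) = pt y]]].

Definition fibre_size (G : triple) (y : 'rV[algC]_3) (m : nat) : Prop :=
  exists s : seq 'M[algC]_3, [/\ uniq s, size s = m & fibre G y = [set` s]].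

Lemma fibre_size_card G y m : fibre_size G y m -> fibre G y #= `I_m.
Proof.
move=> [s [us <- ->]].
have -> : [set` s] = [set` [fset x in s]%fset].
  by apply/seteqP; split => x /=; rewrite inE.
by apply/card_eq_fsetP; rewrite card_fseq undup_id.
Qed.

Lemma fibre_pt G y y' : pt y = pt y' -> fibre G y = fibre G y'.
Proof. by move=> e; rewrite /fibre e. Qed.

Lemma fibre_size_scale G c y m : c != 0 -> fibre_size G (c *: y) m -> fibre_size G y m.
Proof.
by move=> c0 [s [us ss es]]; exists s; split => //; rewrite -es; apply/fibre_pt; rewrite pt_scale.
Qed.

Lemma fibre_iter0 F y : y != 0 -> fibre_size (iter_triple F 0) y 1.
Proof.
move=> y0; exists [:: pt y]; split => //.
have e x : eval_triple (iter_triple F 0) x = x by rewrite eval_iter.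
apply/seteqP; split => [z [x [_ _ +] <-]|z /=].
  by rewrite e /= => ->; rewrite mem_seq1.
by rewrite mem_seq1 => /eqP->; exists y => //; split; rewrite ?e.
Qed.

(** The fibre of the next iterate is the union of the fibres of [f^n] over the two preimages (v:r:w)
    and (v:-r:w), which are distinct since [r] and [v] are nonzero. *)
Lemma fibre_iterS d p n u v w r m : (3 <= d)%N ->
  let c : algC := p%:R ^- (d - 3) in
  v != 0 -> w != 0 -> u + c * w != 0 ->
  r ^+ 2 = v ^+ d / branch_denom c d u v w ->
  fibre_size (iter_triple (ratmap_f d p) n) (coords v r w) m ->
  fibre_size (iter_triple (ratmap_f d p) n) (coords v (- r) w) m ->
  fibre_size (iter_triple (ratmap_f d p) n.+1) (coords u v w) (2 * m).
Proof.
move=> hd c v0 w0 uw0 er [s [us ss es]] [s' [us' ss' es']].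
have r0 : r != 0.
  have : r ^+ 2 != 0.
    by rewrite er !mulf_neq0 ?expf_neq0 // invr_eq0 mulf_neq0 ?expf_neq0.
  by rewrite expf_eq0.
have x0 t : coords v t w != 0 by rewrite coords_eq0 (negbTE v0).
have ptne : pt (coords v r w) <> pt (coords v (- r) w).
  move=> /pt_inj[//|k _]; rewrite scale_coords => /coords_inj[+ + _].
  rewrite -{1}[v]mul1r => /(mulIf v0) <-; rewrite mul1r => /eqP.
  by rewrite -subr_eq0 opprK -mulr2n mulrn_eq0 (negbTE r0).
pose f := iter n (cone_map c d).
have eS x : eval_triple (iter_triple (ratmap_f d p) n.+1) x = cone_map c d (f x).
  by rewrite eval_iter_ratmap.
have eN x : eval_triple (iter_triple (ratmap_f d p) n) x = f x.
  by rewrite eval_iter_ratmap.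
have main x : (cone_map c d (f x) != 0 /\ pt (cone_map c d (f x)) = pt (coords u v w)) <->
    (f x != 0 /\ (pt (f x) = pt (coords v r w) \/ pt (f x) = pt (coords v (- r) w))).
  have y0 : coords u v w != 0 by rewrite coords_eq0 (negbTE v0) /= andbF.
  split=> [[fx0 /(pt_inj fx0)[k k0 ek]]|[fx0 efx]].
    split; first by apply: contra_neq fx0 => ->; rewrite cone_map0.
    have [l l0 [->|->]] := cone_map_fibre hd w0 uw0 er k0 ek; rewrite pt_scale //; by [left|right].
  have [t [l [et l0 ef]]] : exists t l, [/\ t ^+ 2 = r ^+ 2, l != 0 & f x = l *: coords v t w].
    case: efx => /(pt_inj fx0)[l l0 ->]; first by exists r, l.
    by exists (- r), l; rewrite sqrrN.
  have rw0 : l ^+ d * (t ^+ 2 * w ^+ (d - 3)) != 0.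
    by rewrite et !mulf_neq0 ?expf_neq0.
  rewrite ef cone_map_scale // (cone_map_preimage (u := u)) // ?et // scalerA pt_scale -?et //.
  by rewrite scaler_eq0 (negbTE rw0).
exists (s ++ s'); split.
(* A point in both fibres would be sent by [f^n] to two different points. *)
- rewrite cat_uniq us us' andbT /=; apply/hasPn => z zs'; apply/negP => zs.
  have : [set` s] z by [].
  have : [set` s'] z by [].
  rewrite -es -es' => -[x' [x'0 fx'0 e2] <-] [x [x0' fx0 e1]] /(pt_inj x0')[k k0 ek].
  apply: ptne; rewrite -e1 -e2 !eN /f ek iter_cone_map_scale // pt_scale //.
  by rewrite expf_neq0.
- by rewrite size_cat ss ss' addnn mul2n.
- apply/seteqP; split => [_ [x [x00 + +] <-]|z] /=; rewrite mem_cat.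
    rewrite eS => fx0 fx; have [ffx [e|e]] := (main x).1 (conj fx0 fx).
      suff : [set` s] (pt x) by move=> /= ->.
      by rewrite -es; exists x => //; split; rewrite ?eN.
    suff : [set` s'] (pt x) by move=> /= ->; rewrite orbT.
    by rewrite -es'; exists x => //; split; rewrite ?eN.
  move=> /orP[zs|zs].
    have : [set` s] z by [].
    rewrite -es => -[x [x00]]; rewrite eN => fx e <-; exists x => //.
    by have [] := (main x).2 (conj fx (or_introl e)); split; rewrite ?eS.
  have : [set` s'] z by [].
  rewrite -es' => -[x [x00]]; rewrite eN => fx e <-; exists x => //.
  by have [] := (main x).2 (conj fx (or_intror e)); split; rewrite ?eS.
Qed.

(** * Polynomial conditions for generic fibres *)

Definition monom3 (i j k : nat) : {mpoly algC[3]} :=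
  'X_(inord 0) ^+ i * 'X_(inord 1) ^+ j * 'X_(inord 2) ^+ k.

Lemma meval_monom3 i j k x y z :
  (monom3 i j k).@[coords x y z 0] = x ^+ i * y ^+ j * z ^+ k.
Proof.
by rewrite /monom3 !mevalM !rmorphXn /= !mevalXU coords0 coords1 coords2.
Qed.

Lemma meval_mpolyX3 m x y z :
  ('X_[m] : {mpoly algC[3]}).@[coords x y z 0] =
  x ^+ m (inord 0) * y ^+ m (inord 1) * z ^+ m (inord 2).
Proof. by rewrite mevalX big_ord3 coords0 coords1 coords2. Qed.

Lemma mpolyXU_neq0 i : ('X_i : {mpoly algC[3]}) != 0.
Proof.
apply/eqP => /(congr1 (meval (fun=> 1))).
by rewrite mevalXU meval0 => /eqP; rewrite oner_eq0.
Qed.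

Lemma even_odd_parts (q : {mpoly algC[3]}) : exists E O : {mpoly algC[3]},
  forall x y z, q.@[coords x y z 0] =
    E.@[coords x (y ^+ 2) z 0] + y * O.@[coords x (y ^+ 2) z 0].
Proof.
elim/mpolyind: q => [|c m q _ _ [E [O EO]]].
  by exists 0, 0 => x y z; rewrite !meval0 mulr0 addr0.
pose M := c *: monom3 (m (inord 0)) (m (inord 1))./2 (m (inord 2)).
have MP x y z : (c *: 'X_[m]).@[coords x y z 0] =
    y ^+ odd (m (inord 1)) * M.@[coords x (y ^+ 2) z 0].
  rewrite !mevalZ meval_mpolyX3 meval_monom3 -[in LHS](odd_double_half (m (inord 1))).
  by rewrite exprD -mul2n exprM; ring.
case odd_m : (odd (m (inord 1))) in MP.
  by exists E, (O + M) => x y z; rewrite !mevalD MP EO expr1; ring.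
by exists (E + M), O => x y z; rewrite !mevalD MP EO expr0; ring.
Qed.

(** Turns a condition on the fraction [r^2 = a / b] into a polynomial condition on (u, v, w). *)
Lemma clear_denominators (q a b : {mpoly algC[3]}) : exists k (q' : {mpoly algC[3]}),
  forall u v w, b.@[coords u v w 0] != 0 ->
    q'.@[coords u v w 0] = b.@[coords u v w 0] ^+ k *
      q.@[coords v (a.@[coords u v w 0] / b.@[coords u v w 0]) w 0].
Proof.
elim/mpolyind: q => [|c m q _ _ [k [q' qP]]].
  by exists 0%N, 0 => u v w _; rewrite !meval0 mulr0.
exists (k + m (inord 1))%N,
  (c *: ('X_(inord 1) ^+ m (inord 0) * a ^+ m (inord 1) * 'X_(inord 2) ^+ m (inord 2) * b ^+ k)
   + b ^+ m (inord 1) * q').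
move=> u v w b0; rewrite !mevalD !mevalM !mevalZ !mevalM !rmorphXn /= !mevalXU qP //.
rewrite coords1 coords2 meval_mpolyX3.
move: (a.@[_]) (b.@[_]) b0 (q.@[_]) => A B B0 Q.
by rewrite exprD expr_div_n; field; rewrite expf_neq0.
Qed.

(** [q'] is the norm of [q] down the double cover, cleared of denominators, times the factors that
    keep [v], [w] and [u + c * w] away from zero. It is nonzero because it does not vanish at the
    image of a suitable point. *)
Lemma preimage_poly d (c : algC) (q : {mpoly algC[3]}) : (3 <= d)%N -> q != 0 ->
  exists2 q' : {mpoly algC[3]}, q' != 0 & forall u v w, q'.@[coords u v w 0] != 0 ->
    [/\ v != 0, w != 0, u + c * w != 0 &
      forall r, r ^+ 2 = v ^+ d / branch_denom c d u v w -> q.@[coords v r w 0] != 0].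
Proof.
move=> hd q0; have [E [O EO]] := even_odd_parts q.
pose N : {mpoly algC[3]} := E ^+ 2 - 'X_(inord 1) * O ^+ 2.
have NP x y z : N.@[coords x (y ^+ 2) z 0] = q.@[coords x y z 0] * q.@[coords x (- y) z 0].
  rewrite /N mevalB rmorphXn mevalM rmorphXn /= mevalXU coords1 !EO sqrrN.
  by ring.
pose a : {mpoly algC[3]} := 'X_(inord 1) ^+ d.
pose b : {mpoly algC[3]} :=
  'X_(inord 2) ^+ (d - 3) * ('X_(inord 0) + c *: 'X_(inord 2)).
have aP u v w : a.@[coords u v w 0] = v ^+ d.
  by rewrite /a rmorphXn /= mevalXU coords1.
have bP u v w : b.@[coords u v w 0] = branch_denom c d u v w.
  by rewrite /b mevalM mevalD mevalZ rmorphXn /= !mevalXU coords0 coords2.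
have [k [N' N'P]] := clear_denominators N a b.
pose q' := N' * ('X_(inord 1) * 'X_(inord 2) * ('X_(inord 0) + c *: 'X_(inord 2))).
have q'E u v w : q'.@[coords u v w 0] = N'.@[coords u v w 0] * (v * w * (u + c * w)).
  by rewrite /q' !mevalM mevalD mevalZ !mevalXU coords0 coords1 coords2.
exists q'; last first.
  move=> u v w; rewrite q'E !mulf_eq0 => /norP[n0 /norP[/norP[v0 w0] uw0]].
  split => // r er; move: n0; rewrite N'P ?bP ?aP; last first.
    by rewrite /branch_denom mulf_neq0 ?expf_neq0.
  by rewrite -er NP mulf_eq0 => /norP[_]; rewrite mulf_eq0 => /norP[].
suff [u [v [w nz]]] : exists u v w, q'.@[coords u v w 0] != 0.
  by apply: contra_neq nz => ->; rewrite meval0.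
(* A point is sought where neither [q] nor its reflection [qm] nor any coordinate vanishes. *)
pose qm : {mpoly algC[3]} := q \mPo [tuple 'X_(inord 0); - 'X_(inord 1); 'X_(inord 2)].
have qmP x y z : qm.@[coords x y z 0] = q.@[coords x (- y) z 0].
  rewrite comp_mpoly_meval; apply: meval_eq => -[[|[|[|//]]] lt];
    by rewrite (tnth_nth 0) /= ?mevalN mevalXU !mxE inordK.
have coords_meval (h : {mpoly algC[3]}) (t : 'I_3 -> algC) :
    h.@[t] = h.@[coords (t (inord 0)) (t (inord 1)) (t (inord 2)) 0].
  apply: meval_eq => -[[|[|[|//]]] lt]; rewrite mxE /=;
    by congr (t _); apply/val_inj; rewrite /= inordK.
have qm0 : qm != 0.
  apply: contra_neq q0 => qm0; apply: meval_eq0 => t; rewrite coords_meval.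
  by rewrite -[t (inord 1)]opprK -qmP qm0 meval0.
have : q * qm * ('X_(inord 0) * 'X_(inord 1) * 'X_(inord 2)) != 0.
  by rewrite !mulf_neq0 ?mpolyXU_neq0.
move=> /meval_neq0[t]; rewrite coords_meval !mevalM !mevalXU coords0 coords1 coords2.
move: (t _) (t (inord 1)) (t (inord 2)) => x y z; rewrite qmP.
rewrite !mulf_eq0 => /norP[/norP[n1 n2] /norP[/norP[x0 y0] z0]].
(* With this [u] the point (u:x:z) is the image of (x:y:z). *)
pose u := x ^+ d / (y ^+ 2 * z ^+ (d - 3)) - c * z.
have ub : u + c * z = x ^+ d / (y ^+ 2 * z ^+ (d - 3)) by rewrite subrK.
have bb : branch_denom c d u x z = x ^+ d / y ^+ 2.
  by rewrite /branch_denom ub; field; rewrite y0 expf_neq0.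
have b0 : branch_denom c d u x z != 0.
  by rewrite bb mulf_neq0 ?invr_eq0 ?expf_neq0.
exists u, x, z; rewrite q'E N'P ?bP ?aP // bb.
have -> : x ^+ d / (x ^+ d / y ^+ 2) = y ^+ 2 by field; rewrite y0 expf_neq0.
have h1 : x ^+ d / y ^+ 2 != 0 by rewrite -bb.
have h2 : x ^+ d / (y ^+ 2 * z ^+ (d - 3)) != 0.
  by rewrite mulf_neq0 ?invr_eq0 ?expf_neq0 // mulf_neq0 ?expf_neq0.
rewrite NP ub; apply: mulf_neq0; first by apply: mulf_neq0; [exact: expf_neq0 | exact: mulf_neq0].
by apply: mulf_neq0 => //; exact: mulf_neq0.
Qed.

(* In [zero_locus] the condition [x != 0] is elaborated at the type of functions
   ['I_1 -> 'I_3 -> algC]. *)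
Lemma zero_locusP I (y : 'rV[algC]_3) :
  zero_locus I y <-> y != 0 /\ forall q, I q -> q.@[y 0] = 0.
Proof.
split=> -[h1 h2]; split => //.
  apply: contra_neq h1 => ->; apply/funext => i; apply/funext => j.
  by rewrite mxE.
apply: contra_neq h1 => e; apply/matrixP => i j; by rewrite e mxE.
Qed.

Lemma generic_fibre d p n : (3 <= d)%N -> prime p ->
  exists2 q : {mpoly algC[3]}, q != 0 & forall y : 'rV[algC]_3, q.@[y 0] != 0 ->
    y != 0 -> fibre_size (iter_triple (ratmap_f d p) n) y (2 ^ n).
Proof.
move=> hd pp; elim: n => [|n [q q0 qP]].
  by exists 1 => [|y _ y0]; [exact: oner_neq0 | exact: fibre_iter0].
have [q' q'0 q'P] := preimage_poly (p%:R ^- (d - 3)) hd q0.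
exists q' => // y; rewrite [y]coordsE => /q'P[v0 w0 uw0 rP] _.
move: (y 0 _) (y 0 (inord 1)) (y 0 (inord 2)) v0 w0 uw0 rP => u v w v0 w0 uw0 rP.
pose r := sqrtC (v ^+ d / branch_denom (p%:R ^- (d - 3)) d u v w).
have er : r ^+ 2 = v ^+ d / branch_denom (p%:R ^- (d - 3)) d u v w by rewrite sqrtCK.
have x0 t : coords v t w != 0 by rewrite coords_eq0 (negbTE v0).
rewrite expnS; apply: (fibre_iterS (r := r)) => //; apply: qP => //; apply: rP => //.
by rewrite sqrrN.
Qed.

Lemma iter_general_fibre d p n : (3 <= d)%N -> prime p ->
  general_fibre_card (iter_triple (ratmap_f d p) n) (2 ^ n).
Proof.
move=> hd pp; have [q q0 qP] := generic_fibre n hd pp.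
(* [q] need not be homogeneous, so the excluded closed set is cut out by all its homogeneous
   parts. *)
pose I : set {mpoly algC[3]} := [set pihomog mdeg k q | k in [set: nat]].
exists I; split.
- by move=> _ [k _ <-]; exists k; exact: pihomogP.
(* The factor ['X_(inord 0)] ensures that the point found outside the closed set is a nonzero
   vector. *)
- have : q * 'X_(inord 0) != 0 by rewrite mulf_neq0 // mpolyXU_neq0.
  move=> /meval_neq0[t]; rewrite mevalM mevalXU mulf_eq0 => /norP[qt t0].
  exists (\row_i t i); split.
    by apply/eqP => /rowP/(_ (inord 0)); rewrite !mxE => /eqP; rewrite (negbTE t0).
  move=> /zero_locusP[_ Iz]; move/eqP: qt; apply.
  rewrite (@pihomog_partitionE _ _ mdeg (msize q) q (leqnn _)) raddf_sum big1 // => k _.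
  transitivity (pihomog mdeg k q).@[(\row_i t i : 'rV[algC]_3) 0].
    by apply: meval_eq => i; rewrite mxE.
  by apply: Iz; exists k.
- move=> y y0 yI; apply: fibre_size_card.
  have [k qk] : exists k, (pihomog mdeg k q).@[y 0] != 0.
    apply: contrapT => /forallNP nk; apply/yI/zero_locusP; split=> // _ [k _ <-].
    by apply/eqP/negPn/negP; exact: nk.
  have [c c0 qc] := pihomog_scale_neq0 qk.
  apply: (fibre_size_scale c0); apply: qP; last by rewrite scaler_eq0 negb_or c0.
  by move: qc; congr (_ != 0); apply: meval_eq => i; rewrite mxE.
Qed.

Lemma dynamical_degree2 (R : realType) d p : (3 <= d)%N -> prime p ->
  is_dynamical_degree 2 (ratmap_f d p) (2%:R : R).
Proof.
move=> hd pp; exists (fun n => (2 ^ n)%N); split; last exact: powR_expn_cvg.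
move=> n; exists (d ^ n)%N, (iter_triple (ratmap_f d p) n); split.
  exact: iter_reduced.
exact: iter_general_fibre.
Qed.

(** * The map for d = 4 and p = 2 *)

Lemma ratmap_hyperbolic (R : realType) d p : (3 <= d)%N -> prime p ->
  cohomologically_hyperbolic R 1 (ratmap_f d p).
Proof.
move=> hd pp; exists (fun i => if i == 1%N then d%:R else 2%:R); split.
  by move=> [|[|[|i]]] //= _; [exact: dynamical_degree1|exact: dynamical_degree2].
have d2 : 2 < d%:R :> R by rewrite ltr_nat.
split; first by split => // -[|[|[|i]]] //= _; rewrite ltW.
by move=> [|[|[|j]]] [//= _ /(_ 1%N isT)] /=; rewrite leNgt d2.
Qed.

Lemma ratmap42_reduced : is_reduced_form (ratmap_f 4 2) 4 (ratmap_f 4 2).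
Proof. exact: ratmap_reduced. Qed.

Lemma eval_ratmap42 x y u : y ^+ 2 * (u + 2^-1) = x ^+ 4 ->
  eval_triple (ratmap_f 4 2) (coords x y 1) = y ^+ 2 *: coords u x 1.
Proof.
move=> e; rewrite eval_ratmap /cone_map coords0 coords1 coords2 scale_coords.
by rewrite -e !expr1n; congr coords; field.
Qed.

Lemma ratmap42_maps_to x y u : y != 0 -> y ^+ 2 * (u + 2^-1) = x ^+ 4 ->
  maps_to (ratmap_f 4 2) (coords x y 1) (coords u x 1) /\
  (P2 `\` indeterminacy_locus (ratmap_f 4 2)) (coords x y 1).
Proof.
move=> y0 e; have y20 : y ^+ 2 != 0 by rewrite expf_neq0.
have nz : eval_triple (ratmap_f 4 2) (coords x y 1) != 0.
  rewrite (eval_ratmap42 e) scaler_eq0 (negbTE y20) coords_eq0 /=.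
  by rewrite oner_eq0 !andbF.
split; last split.
- exists 4%N, (ratmap_f 4 2); split => //; first exact: ratmap42_reduced.
  by rewrite (eval_ratmap42 e) pt_scale.
- by rewrite /P2 /= coords_eq0 oner_eq0 !andbF.
- move=> [_ /(_ _ _ ratmap42_reduced) e0]; by rewrite e0 eqxx in nz.
Qed.

(** Each Galois conjugate of the point lies on a conjugate backward orbit, so its first coordinate
    has the same 3-adic size. *)
Lemma height_backward_orbit (R : realType) b s n : backward_orbit b s ->
  growth R n <= height R (coords (s n.+2) (s n.+3) 1).
Proof.
move=> bs; apply: (@height_ge R _ 3 _ (inord 2)) => //; first exact: coords2.
move=> _ [nu _ <-]; have wP : extends_place (Some 3%N) (absv R (Some 3%N)).
  have [w wP] := exists_extends_place R (isT : prime 3).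
  exact: (xgetI (fun=> 0) wP).
have le : expR (growth R n) <=
    \big[Num.max/0]_(i < 3) absv R (Some 3%N) (map_mx nu (coords (s n.+2) (s n.+3) 1) 0 i).
  apply: le_trans (le_bigmax _ _ (inord 0)).
  by rewrite mxE coords0 -(place3_orbit n wP (backward_orbit_morph nu bs)).
rewrite /local_height -[leLHS]expRK ler_ln // posrE ?expR_gt0 //.
exact: lt_le_trans (expR_gt0 _) le.
Qed.

Lemma fixed_point_eq (a : algC) : a = (1 + sqrtC 3%:R) / 2%:R -> a ^+ 2 = a + 2^-1.
Proof.
move=> ->; have e : sqrtC 3%:R ^+ 2 = 3%:R :> algC by rewrite sqrtCK.
rewrite expr_div_n sqrrD e; by field.
Qed.

Unset Implicit Arguments.

Theorem theorem1p9 (R : realType) (d p : nat) (hd : (3 <= d)%N)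
    (hp : prime p) :
  [/\ is_dynamical_degree 1 (ratmap_f d p) (d%:R : R),
      is_dynamical_degree 2 (ratmap_f d p) (2%:R : R) &
      cohomologically_hyperbolic R 1 (ratmap_f d p)]
  /\
  let a : algC := (1 + sqrtC 3%:R) / 2%:R in
  let f := ratmap_f 4 2 in
  let P0 := coords a a 1 in
  maps_to f P0 P0 /\
  exists P : nat -> 'rV[algC]_3,
    [/\ P 0%N = P0,
        forall n, (1 <= n)%N -> (P2 `\` indeterminacy_locus f) (P n),
        forall n, (1 <= n)%N -> maps_to f (P n) (P n.-1),
        zariski_dense (range P) &
        (fun n => height R (P n)) @ \oo --> +oo].
Proof.
split.
  by split; [exact: dynamical_degree1|exact: dynamical_degree2|exact: ratmap_hyperbolic].
move=> a f P0; have ea : a ^+ 2 = a + 2^-1 by exact: fixed_point_eq.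
have [s bs] := exists_backward_orbit ea; have [_ s0 s1 sS] := bs.
(* The orbit starts with a, a, -a, a; the sign of the third term makes it leave the fixed point. *)
pose u n := if n is m.+2 then s m else a.
have a0 : a != 0 by rewrite -s1; case: (backward_orbit_neq0 R 1 bs).
have u0 n : u n != 0.
  by case: n => [|[|n]] //=; case: (backward_orbit_neq0 R n bs).
have uS n : u n.+2 ^+ 2 * (u n + 2^-1) = u n.+1 ^+ 4.
  case: n => [|[|n]] /=.
  - by rewrite s0 sqrrN -ea -exprD.
  - by rewrite s1 s0 -ea; ring.
  - by rewrite sS mulfVK //; case: (backward_orbit_neq0 R n bs).
have P0a : maps_to f P0 P0.
  (* The fixed point is the case in which all three parameters equal [a], where the equation reads
     [a^2 * a^2 = a^4]. *)
  by have [] := @ratmap42_maps_to a a a a0; rewrite -?ea -?exprD.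
split => //; pose P n := coords (u n) (u n.+1) 1.
exists P; split => //.
- move=> [//|n] _; exact: (ratmap42_maps_to (u0 _) (uS n)).2.
- move=> [//|n] _; exact: (ratmap42_maps_to (u0 _) (uS n)).1.
- move=> I Ih PI y y0; apply/zero_locusP; split => // q Iq.
  have [k qk] := Ih _ Iq.
  have [->|q0] := eqVneq q 0; first by rewrite meval0.
  have [n] := homog_nonvanishing R bs qk q0.
  have /zero_locusP[_ Pz] : zero_locus I (P n.+4) by apply: PI; exists n.+4.
  (* The shift by 4 combines [u n.+2 = s n] with the index [n.+2] at which the 3-adic growth of [s]
     begins. *)
  by rewrite -[coords _ _ _]/(P n.+4) Pz // eqxx.
- apply/cvgryPge => A; have /cvgryPge/(_ A)[N _ HN] := @growth_cvg R.
  near=> n; have n4 : (N.+4 <= n)%N by near: n; exact: nbhs_infty_ge.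
  have [m Nm ->] : exists2 m, (N <= m)%N & n = m.+4 by exists (n - 4)%N; lia.
  exact: le_trans (HN m Nm) (height_backward_orbit R m bs).
Unshelve. all: by end_near.
Qed.
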